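(* Suppose that $(A|\mathbb{G})$ is exponentially mean-square stable. Let $\mathfrak{L}_{D=0}$ be the input-to-output operator of the Markov jump linear system $x(k+1)=A(\vartheta(k))x(k)+B(\vartheta(k))v(k)$, $z(k)=C(\vartheta(k))x(k)$, $k\in\mathbb{N}$. Then $$r(A;B,C|\mathbb{G})\geq \|\mathfrak{L}_{D=0}\|_{\infty}^{-1},$$ where $r(A;B,C|\mathbb{G})$ is the stability radius $$r(A;B,C|\mathbb{G})=\inf\{\|\Delta\|_{\mathcal{H}^{r\times r}_{\infty}} : \Delta\in\mathcal{H}^{r\times r}_{\infty},\ x(k+1)=[A(\vartheta(k))+B(\vartheta(k))\Delta(\vartheta(k))C(\vartheta(k))]x(k) \text{ is not exponentially mean-square stable}\}.$$
   Context: $\Theta$ is a Borel subset of a separable complete metric space, $\mathcal{B}(\Theta)$ its Borel $\sigma$-algebra, $\mu$ a $\sigma$-finite measure on it. Matrices carry the spectral norm. $\mathcal{H}^{n\times m}_{\infty}$: measurable $P:\Theta\to\mathbb{R}^{n\times m}$ with $\|P\|_{\mathcal{H}^{n\times m}_\infty}=\operatorname{ess\,sup}_\ell\|P(\ell)\|<\infty$. Markov chain: $\{\vartheta(k)\}_{k\in\mathbb{N}}$ takes values in $\Theta$, with initial distribution having density $\nu_0$ with respect to $\mu$, and stochastic kernel $\mathbb{G}(\ell,\Lambda)=\int_\Lambda g(\ell,t)\mu(dt)$. Standing assumptions: $\nu_0(\ell)>0$ $\mu$-a.e. and $\int_\Theta g(t,\ell)\mu(dt)>0$ $\mu$-a.e.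 $\mathfrak{F}_k=\sigma(\vartheta(0),\dots,\vartheta(k))$, $\vartheta_0=\vartheta(0)$. $A\in\mathcal{H}^{n\times n}_\infty$, $B\in\mathcal{H}^{n\times r}_\infty$, $C\in\mathcal{H}^{r\times n}_\infty$. $(A|\mathbb{G})$ denotes $x(k+1)=A(\vartheta(k))x(k)$; such an autonomous system is exponentially mean-square stable if there are $\beta>0$, $\alpha\in(0,1)$ such that for any initial conditions $(x_0,\vartheta_0)$, with $x_0\in\mathbb{R}^n$ deterministic, $\mathbf{E}\{\|x(k)\|^2\}\le\beta\alpha^k\|x_0\|^2$ for all $k\in\mathbb{N}$. $l^2(\mathbb{N};\mathbb{R}^r)$ is the Hilbert space of random sequences $v$ with $v(k)$ $\mathbb{R}^r$-valued and $\mathfrak{F}_k$-measurable and $\|v\|^2=\sum_{k}\mathbf{E}\|v(k)\|^2<\infty$. The input-to-output operator maps $v\in l^2(\mathbb{N};\mathbb{R}^r)$ to the output $z$ with $x(0)=0$, and $\|\mathfrak{L}\|_\infty=\inf\{\sqrt\gamma:\gamma>0,\ \|\mathfrak{L}(v)\|^2-\gamma\|v\|^2<0 \text{ for any }\vartheta_0\text{ and any nonzero } v\in l^2(\mathbb{N};\mathbb{R}^r)\}$. Conventions: $\inf\emptyset=+\infty$, $0^{-1}=+\infty$. *)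

(* Defs.v *)
From HB Require Import structures.
From mathcomp Require Import all_boot all_order all_algebra.
From mathcomp Require Import all_classical all_reals all_analysis.
From mathcomp Require Import ess_sup_inf.

Set Implicit Arguments.
Unset Strict Implicit.
Unset Printing Implicit Defensive.

Import Order.TTheory GRing.Theory Num.Theory.
Import numFieldNormedType.Exports.

Local Open Scope classical_set_scope.
Local Open Scope ring_scope.

(* Filter form of metric completeness; stated as a predicate because
   [completeType] would force the space to be pointed. *)
Definition complete_space (S : uniformType) : Prop :=
  forall F : set_system S, ProperFilter F -> cauchy F -> exists x : S, F --> x.

Definition separable_space (S : topologicalType) : Prop :=
  exists2 D : set S, countable D & dense D.

(* The carrier of a subset [X] of [S].  Measurable types are pointed, hence the
   witness [x0] that [X] is nonempty; it plays no other role. *)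
Definition pointed_subset (S : topologicalType) (X : set S) (x0 : X) : Type :=
  set_type X.

HB.instance Definition _ (S : topologicalType) (X : set S) (x0 : X) :=
  Choice.copy (pointed_subset x0) (set_type X).
HB.instance Definition _ (S : topologicalType) (X : set S) (x0 : X) :=
  isPointed.Build (pointed_subset x0) x0.

(* [X] with the Borel sigma-algebra of its subspace topology. *)
Definition subset_open (S : topologicalType) (X : set S) (x0 : X)
    : set (set (pointed_subset x0)) :=
  @open (set_type X).
Arguments subset_open {S X} x0.

Notation borel_subset x0 := (g_sigma_algebraType (subset_open x0)).

Section matrix_norms.
Context {R : realType}.

Definition enorm n (x : 'cV[R]_n) : R := Num.sqrt (\sum_(i < n) x i 0 ^+ 2).

Definition spectral_norm n m (M : 'M[R]_(n, m)) : R :=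
  sup [set enorm (M *m x) | x in [set x : 'cV[R]_m | enorm x <= 1]].

End matrix_norms.

Section Hinf.
Context {R : realType} {d : measure_display} {T : measurableType d}.
Variable mu : {measure set T -> \bar R}.

Definition Hinf_norm n m (M : T -> 'M[R]_(n, m)) : \bar R :=
  ess_sup mu (fun l => (spectral_norm (M l))%:E).

Definition Hinf n m : set (T -> 'M[R]_(n, m)) :=
  [set M : T -> 'M[R]_(n, m) | (forall i j, measurable_fun [set: T] (fun l => M l i j)) /\
           (Hinf_norm M < +oo)%E].

End Hinf.

Section markov_chain.
Context {R : realType} {d : measure_display} {T : measurableType d}.
Variables (mu : {measure set T -> \bar R}) (G : R.-pker T ~> T).

(* That [nu0] integrates to 1 follows from [is_markov_chain] below. *)
Definition initial_density (nu0 : T -> R) : Prop :=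
  [/\ measurable_fun [set: T] nu0,
      forall l, 0 <= nu0 l &
      {ae mu, forall l, 0 < nu0 l}].

Definition natural_filtration (Omega : Type) (theta : nat -> Omega -> T)
    (k : nat) : set (set Omega) :=
  <<s \bigcup_(i in [set i | (i <= k)%N])
        preimage_set_system setT (theta i) measurable >>.

(* The last clause says that [G (theta k) L] is a version of the conditional
   probability of [theta k.+1 \in L] given [natural_filtration theta k]. *)
Definition is_markov_chain (nu0 : T -> R) (dO : measure_display)
    (Omega : measurableType dO) (P : probability Omega R)
    (theta : nat -> Omega -> T) : Prop :=
  [/\ forall k, measurable_fun [set: Omega] (theta k),
      forall L, measurable L ->
        P (theta 0%N @^-1` L) = (\int[mu]_(l in L) (nu0 l)%:E)%E &
      forall k F L, natural_filtration theta k F -> measurable L ->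
        P (F `&` theta k.+1 @^-1` L) = (\int[P]_(w in F) G (theta k w) L)%E].

End markov_chain.

Section jump_systems.
Context {R : realType} {d : measure_display} {T : measurableType d}.

Fixpoint free_state n (Omega : Type) (A : T -> 'M[R]_n)
    (theta : nat -> Omega -> T) (x0 : 'cV[R]_n) (k : nat) (w : Omega)
    : 'cV[R]_n :=
  if k is j.+1 then A (theta j w) *m free_state A theta x0 j w else x0.

Fixpoint forced_state n r (Omega : Type) (A : T -> 'M[R]_n)
    (B : T -> 'M[R]_(n, r)) (theta : nat -> Omega -> T)
    (v : nat -> Omega -> 'cV[R]_r) (k : nat) (w : Omega) : 'cV[R]_n :=
  if k is j.+1 then
    A (theta j w) *m forced_state A B theta v j w + B (theta j w) *m v j w
  else 0.

Definition io_operator n r (Omega : Type) (A : T -> 'M[R]_n)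
    (B : T -> 'M[R]_(n, r)) (C : T -> 'M[R]_(r, n))
    (theta : nat -> Omega -> T) (v : nat -> Omega -> 'cV[R]_r)
    : nat -> Omega -> 'cV[R]_r :=
  fun k w => C (theta k w) *m forced_state A B theta v k w.

Section signals.
Context (dO : measure_display) (Omega : measurableType dO).
Variable P : probability Omega R.

Definition l2_sqnorm r (v : nat -> Omega -> 'cV[R]_r) : \bar R :=
  (\sum_(0 <= k <oo) 'E_P[fun w => (enorm (v k w) ^+ 2)%R])%E.

Definition l2 r (theta : nat -> Omega -> T)
    : set (nat -> Omega -> 'cV[R]_r) :=
  [set v : nat -> Omega -> 'cV[R]_r | (forall k i (Y : set R), measurable Y ->
              natural_filtration theta k ((fun w => v k w i 0) @^-1` Y)) /\
           (l2_sqnorm v < +oo)%E].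

(* Elements of l2 are random sequences up to almost sure equality. *)
Definition l2_zero r (v : nat -> Omega -> 'cV[R]_r) : Prop :=
  forall k, {ae P, forall w, v k w = 0}.

End signals.

Variables (mu : {measure set T -> \bar R}) (G : R.-pker T ~> T).

(* "For any theta_0" ranges over all initial random variables whose law has an
   admissible density, with the kernel [G] fixed: the quantification is over
   all Markov chains with kernel [G] and such an initial density, on any
   probability space.  The constants [beta] and [alpha] do not depend on the
   initial density. *)
Definition ems_stable n (A : T -> 'M[R]_n) : Prop :=
  exists beta alpha : R, [/\ 0 < beta, 0 < alpha < 1 &
    forall (nu0 : T -> R) (dO : measure_display) (Omega : measurableType dO)
      (P : probability Omega R) (theta : nat -> Omega -> T) (x0 : 'cV[R]_n),
    initial_density mu nu0 -> is_markov_chain mu G nu0 P theta ->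
    forall k : nat,
      ('E_P[fun w => (enorm (free_state A theta x0 k w) ^+ 2)%R]
         <= (beta * alpha ^+ k * enorm x0 ^+ 2)%R%:E)%E].

Definition io_norm n r (A : T -> 'M[R]_n) (B : T -> 'M[R]_(n, r))
    (C : T -> 'M[R]_(r, n)) : \bar R :=
  ereal_inf [set (Num.sqrt gamma)%:E | gamma in [set gamma : R | 0 < gamma /\
    forall (nu0 : T -> R) (dO : measure_display) (Omega : measurableType dO)
      (P : probability Omega R) (theta : nat -> Omega -> T)
      (v : nat -> Omega -> 'cV[R]_r),
    initial_density mu nu0 -> is_markov_chain mu G nu0 P theta ->
    l2 P theta v -> ~ l2_zero P v ->
    (l2_sqnorm P (io_operator A B C theta v) - gamma%:E * l2_sqnorm P v
       < 0)%E]].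

Definition stability_radius n r (A : T -> 'M[R]_n) (B : T -> 'M[R]_(n, r))
    (C : T -> 'M[R]_(r, n)) : \bar R :=
  ereal_inf [set Hinf_norm mu Delta | Delta in
    [set Delta : T -> 'M[R]_r | Hinf mu Delta /\
       ~ ems_stable (fun l => A l + B l *m Delta l *m C l)]].

End jump_systems.

(* Main.v *)
(** Let Delta have essential norm del < ||L||^-1, and pick an admissible gamma with
    gamma * del^2 < 1.  Along the closed loop put z = C x and v = Delta z, so that
    x is the free trajectory plus the response to v.  The gain inequality applied
    to the truncations of v, with Young's inequality, bounds sum_(k < N) E|z(k)|^2
    by a multiple of |x0|^2 uniformly in N.  Together with the exponential decay
    of the free evolution this makes sum_k E|x(k)|^2 summable with the same kind of
    bound, and Datko's argument upgrades summability to exponential decay.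

    Both uses of stability after time 0 start the chain at a later time from a
    state depending on the past.  Since stability is only assumed on average over
    admissible initial laws, the past is handled by a change of measure: weighting
    P by a function of theta(0), ..., theta(j) leaves theta(j+1), theta(j+2), ... a
    Markov chain with kernel G, whose initial law still has a positive density. *)

Require Import Defs.
From HB Require Import structures.
From mathcomp Require Import all_boot all_order all_algebra.
From mathcomp Require Import all_classical all_reals all_analysis.
From mathcomp Require Import measurable_realfun ess_sup_inf ring lra.

Set Implicit Arguments.
Unset Strict Implicit.
Unset Printing Implicit Defensive.

Import Order.TTheory GRing.Theory Num.Theory.
Import numFieldNormedType.Exports.

Local Open Scope classical_set_scope.
Local Open Scope ring_scope.

(** * Euclidean and spectral norms *)

Section euclidean_norm.
Context {R : realType}.

Lemma enorm_ge0 n (x : 'cV[R]_n) : 0 <= enorm x.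
Proof. exact: sqrtr_ge0. Qed.

Lemma sqr_enorm n (x : 'cV[R]_n) : enorm x ^+ 2 = \sum_(i < n) x i 0 ^+ 2.
Proof. by rewrite sqr_sqrtr// sumr_ge0// => i _; exact: sqr_ge0. Qed.

Lemma enorm0 n : enorm (0 : 'cV[R]_n) = 0.
Proof.
by rewrite /enorm big1 ?sqrtr0// => i _; rewrite mxE expr0n.
Qed.

Lemma sqr_enormZ n (a : R) (x : 'cV[R]_n) :
  enorm (a *: x) ^+ 2 = a ^+ 2 * enorm x ^+ 2.
Proof.
rewrite !sqr_enorm mulr_sumr; apply: eq_bigr => i _.
by rewrite mxE exprMn.
Qed.

Lemma enormZ n (a : R) (x : 'cV[R]_n) : 0 <= a -> enorm (a *: x) = a * enorm x.
Proof.
move=> a0; apply/eqP; rewrite -(@eqrXn2 _ 2)// ?mulr_ge0 ?enorm_ge0//.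
by rewrite sqr_enormZ exprMn.
Qed.

(** Coordinatewise, the right side exceeds the left by the square [e^-1 * (e * a - b) ^+ 2]. *)
Lemma sqr_enormD_young n (e : R) (x y : 'cV[R]_n) : 0 < e ->
  enorm (x + y) ^+ 2 <= (1 + e) * enorm x ^+ 2 + (1 + e^-1) * enorm y ^+ 2.
Proof.
move=> e0; rewrite !sqr_enorm !mulr_sumr -big_split/=; apply: ler_sum => i _.
rewrite mxE; set a := x i 0; set b := y i 0.
have -> : (1 + e) * a ^+ 2 + (1 + e^-1) * b ^+ 2 =
   (a + b) ^+ 2 + e^-1 * (e * a - b) ^+ 2.
  by field; rewrite gt_eqF.
by rewrite lerDl mulr_ge0 ?sqr_ge0// invr_ge0 ltW.
Qed.

(** Cauchy-Schwarz against the constant vector, read off from the nonnegativity of the variance of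
    [a] about its mean [s / n]. *)
Lemma sqr_sum_le n (a : 'I_n -> R) :
  (\sum_i a i) ^+ 2 <= n%:R * \sum_i a i ^+ 2.
Proof.
have [n0|n0] := posnP n; first by subst n; rewrite !big_ord0 expr0n mulr0.
set s := \sum_i a i; have nR : 0 < n%:R :> R by rewrite ltr0n.
have : 0 <= n%:R * \sum_i (a i - s / n%:R) ^+ 2.
  by rewrite mulr_ge0// sumr_ge0// => i _; exact: sqr_ge0.
have -> : \sum_i (a i - s / n%:R) ^+ 2 = \sum_i a i ^+ 2 - s ^+ 2 / n%:R.
  have -> : \sum_i (a i - s / n%:R) ^+ 2 =
      \sum_i (a i ^+ 2 - 2 * (s / n%:R) * a i + (s / n%:R) ^+ 2).
    by apply: eq_bigr => i _; ring.
  rewrite big_split/= sumrB -mulr_sumr -/s sumr_const card_ord -mulr_natl.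
  by field; rewrite gt_eqF.
by rewrite mulrBr subr_ge0 mulrCA divff ?mulr1// gt_eqF.
Qed.

Lemma sqr_enorm_sum n m (y : 'I_m -> 'cV[R]_n) :
  enorm (\sum_i y i) ^+ 2 <= m%:R * \sum_i enorm (y i) ^+ 2.
Proof.
rewrite sqr_enorm; under [X in _ <= _ * X]eq_bigr do rewrite sqr_enorm.
rewrite exchange_big/= mulr_sumr; apply: ler_sum => i _.
by rewrite summxE sqr_sum_le.
Qed.

Lemma colE n (x : 'cV[R]_n) : x = \sum_i x i 0 *: delta_mx i 0.
Proof.
rewrite {1}(matrix_sum_delta x); apply: eq_bigr => i _.
by rewrite big_ord1 ord1.
Qed.

Lemma enorm_delta n (i : 'I_n) : enorm (delta_mx i 0 : 'cV[R]_n) = 1.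
Proof.
rewrite /enorm (bigD1 i)//= big1 => [|j ji]; rewrite mxE ?eqxx.
  by rewrite expr1n addr0 sqrtr1.
by rewrite (negbTE ji) expr0n.
Qed.

(** Boundedness is what makes the real [sup] in [spectral_norm] meaningful. Expanding [x] in the
    standard basis gives [|M x|^2 <= K], and [t ^+ 2 <= K] forces [t <= 1 + K] without a square
    root. *)
Lemma spectral_set_ubound n m (M : 'M[R]_(n, m)) :
  has_ubound [set enorm (M *m x) | x in [set x : 'cV[R]_m | enorm x <= 1]].
Proof.
pose K := m%:R * \sum_j enorm (M *m delta_mx j 0) ^+ 2.
have K0 : 0 <= K.
  by rewrite mulr_ge0// sumr_ge0// => i _; exact: sqr_ge0.
exists (1 + K) => _ [x /= x1 <-].
have x1i i : x i 0 ^+ 2 <= 1.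
  rewrite (@le_trans _ _ (enorm x ^+ 2))//; last first.
    by rewrite -(expr1n _ 2) lerXn2r// nnegrE ?enorm_ge0.
  rewrite sqr_enorm (bigD1 i)//= lerDl sumr_ge0// => j _; exact: sqr_ge0.
have : enorm (M *m x) ^+ 2 <= K.
  rewrite {1}(colE x) mulmx_sumr (le_trans (sqr_enorm_sum _))//.
  rewrite ler_wpM2l// ler_sum// => i _.
  by rewrite -scalemxAr sqr_enormZ ler_piMl// sqr_ge0.
move: (enorm_ge0 (M *m x)) => ? ?; nra.
Qed.

Lemma spectral_norm_ge0 n m (M : 'M[R]_(n, m)) : 0 <= spectral_norm M.
Proof.
apply: (ub_le_sup (spectral_set_ubound M)).
by exists 0; rewrite /= ?mulmx0 enorm0// ler01.
Qed.

Lemma enorm_mulmx_le n m (M : 'M[R]_(n, m)) (x : 'cV[R]_m) :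
  enorm (M *m x) <= spectral_norm M * enorm x.
Proof.
have [x0|x0] := eqVneq (enorm x) 0.
  have x00 : x = 0.
    have := sqr_enorm x; rewrite x0 expr0n/= => /esym/eqP.
    rewrite psumr_eq0 => [/allP h|i _]; last exact: sqr_ge0.
    apply/matrixP => i j; rewrite ord1 mxE; apply/eqP; rewrite -sqrf_eq0.
    exact: (h i (mem_index_enum i)).
  by rewrite x00 mulmx0 !enorm0 mulr0.
have xp : 0 < enorm x by rewrite lt_def x0 enorm_ge0.
rewrite -ler_pdivrMr//.
apply: (ub_le_sup (spectral_set_ubound M)).
exists ((enorm x)^-1 *: x) => /=.
  by rewrite enormZ ?invr_ge0 ?enorm_ge0// mulVf.
by rewrite -scalemxAr enormZ ?invr_ge0 ?enorm_ge0// mulrC.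
Qed.

Lemma sqr_enorm_mulmx_le n m (M : 'M[R]_(n, m)) (x : 'cV[R]_m) (c : R) :
  spectral_norm M <= c -> enorm (M *m x) ^+ 2 <= c ^+ 2 * enorm x ^+ 2.
Proof.
move=> Mc; rewrite -exprMn lerXn2r ?nnegrE ?enorm_ge0//.
  by rewrite mulr_ge0 ?enorm_ge0// (le_trans _ Mc)// spectral_norm_ge0.
by rewrite (le_trans (enorm_mulmx_le M x))// ler_wpM2r ?enorm_ge0.
Qed.

End euclidean_norm.

(** * Change of measure for Markov chains *)

Section transition_density.
Context {R : realType} {d : measure_display} {T : measurableType d}.
Variable mu : {sigma_finite_measure set T -> \bar R}.
Variable G : R.-pker T ~> T.
Variable g : T * T -> R.
Hypothesis g_measurable : measurable_fun setT g.
Hypothesis g_ge0 : forall l t, 0 <= g (l, t).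
Hypothesis G_density : forall l L, measurable L ->
  G l L = (\int[mu]_(t in L) (g (l, t))%:E)%E.
Hypothesis g_pos : {ae mu, forall l, (0 < \int[mu]_t (g (t, l))%:E)%E}.
Local Open Scope ereal_scope.

(** Positivity of the density makes the initial law equivalent to [mu], not merely absolutely
    continuous. *)
Lemma initial_density_null (nu0 : T -> R) (L : set T) :
  initial_density mu nu0 -> measurable L ->
  \int[mu]_(l in L) (nu0 l)%:E = 0 <-> mu L = 0.
Proof.
move=> [mnu nu0_ge0 nu0_gt0] mL.
have mnuL : measurable_fun L (fun l => (nu0 l)%:E).
  exact/measurable_funTS/measurable_EFinP.
split=> [intL0|muL0]; last exact: null_set_integral.
have : ae_eq mu L (fun l => (nu0 l)%:E) (cst 0).
  apply/(ae_eq_integral_abs mu mL mnuL); rewrite -[RHS]intL0.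
  by apply: eq_integral => l _; rewrite gee0_abs// lee_fin.
move=> nu_eq0; apply: measure_negligible => //.
have : {ae mu, forall l, ~ L l}.
  apply: filterS2 nu0_gt0 nu_eq0 => l nul /[apply] -[nul0].
  by rewrite nul0 ltxx in nul.
by apply: negligibleS => l /= Ll; exact.
Qed.

(** By Tonelli the law of the next state has density [q t], the [Q]-mean of [g (Y w, t)]. It is
    finite a.e. since its integral is at most 1. It is positive a.e.: if [q t = 0], then [g (l, t)]
    vanishes for almost every [l] under the law of [Y], hence for [mu]-almost every [l], against
    [g_pos]. *)
Lemma transition_density (dO : measure_display) (Omega : measurableType dO)
    (Q : probability Omega R) (Y : Omega -> T) :
  measurable_fun setT Y ->
  (forall N, measurable N -> Q (Y @^-1` N) = 0 -> mu N = 0) ->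
  exists2 nu0, initial_density mu nu0 &
    forall L, measurable L ->
      \int[Q]_w G (Y w) L = \int[mu]_(l in L) (nu0 l)%:E.
Proof.
move=> mY muQ.
pose f (z : Omega * T) := (g (Y z.1, z.2))%:E.
have mf : measurable_fun setT f.
  apply/measurable_EFinP.
  apply: (@measurableT_comp _ _ _ _ _ _ g _ (fun z => (Y z.1, z.2))) => //.
  by apply: measurable_fun_pair => //=; exact: measurableT_comp.
have f0 z : 0 <= f z by rewrite lee_fin.
pose q := fubini_G Q f.
have q0 t : 0 <= q t by apply: integral_ge0.
have mq : measurable_fun setT q by exact: measurable_fun_fubini_tonelli_G.
have mfl w : measurable_fun setT (fun t => f (w, t)).
  exact: measurable_fun_pair2.
have mfr t : measurable_fun setT (fun w => f (w, t)).
  exact: measurable_fun_pair1.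
have qE L : measurable L -> \int[Q]_w G (Y w) L = \int[mu]_(t in L) q t.
  move=> mL.
  transitivity (\int[Q]_w \int[mu]_t (f (w, t) * (\1_L t)%:E)).
    apply: eq_integral => w _; rewrite G_density// integral_mkcond.
    by rewrite epatch_indic.
  rewrite (@fubini_tonelli _ _ _ _ _ _ _ (fun z => f z * (\1_L z.2)%:E)).
  - rewrite [RHS]integral_mkcond epatch_indic; apply: eq_integral => t _ /=.
    by rewrite ge0_integralZr// lee_fin.
  - apply: emeasurable_funM => //; apply/measurable_EFinP.
    by apply: (measurableT_comp (measurable_indic mL)); exact: measurable_snd.
  - by move=> z; rewrite mule_ge0// lee_fin.
have q_fin : {ae mu, forall t, q t \is a fin_num}.
  have : mu.-integrable setT q.
    apply/integrableP; split => //.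
    under eq_integral do rewrite gee0_abs//.
    rewrite -qE//; under eq_integral do rewrite prob_kernel.
    by rewrite integral_cst// mul1e (le_lt_trans (probability_le1 Q _)) ?ltry.
  by move/(integrable_ae measurableT); apply: filterS => t /(_ I).
have q_gt0 : {ae mu, forall t, 0 < q t}.
  apply: filterS g_pos => t; apply: contraPP => /negP.
  rewrite -leNgt => qt0.
  have {qt0} : ae_eq Q setT (fun w => f (w, t)) (cst 0).
    apply/ae_eq_integral_abs => //.
    under eq_integral do rewrite gee0_abs//.
    by apply/eqP; rewrite eq_le qt0 q0.
  move=> ft0.
  have mgt : measurable_fun setT (fun l => (g (l, t))%:E).
    by apply/measurable_EFinP; exact: measurable_fun_pair1.
  have mN : measurable [set l | (g (l, t))%:E != 0].
    by rewrite -[X in measurable X]setTI; exact: emeasurable_neq.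
  have : mu [set l | (g (l, t))%:E != 0] = 0.
    apply: muQ => //; apply: measure_negligible.
      by rewrite -[X in measurable X]setTI; exact: mY.
    by apply: negligibleS ft0 => w /= /eqP Yw0 /(_ I)/Yw0.
  move=> muN. suff -> : \int[mu]_l (g (l, t))%:E = 0 by rewrite ltxx.
  transitivity (\int[mu]_l `|(g (l, t))%:E|).
    by apply: eq_integral => l _; rewrite gee0_abs// lee_fin.
  apply/ae_eq_integral_abs => //; exists [set l | (g (l, t))%:E != 0]; split => //.
  by move=> l /= h; apply/eqP => gl0; apply: h.
exists (fine \o q); first split.
- by apply: measurableT_comp => //; exact: measurable_fine.
- by move=> t; rewrite fine_ge0.
- apply: filterS2 q_fin q_gt0 => t qf; by rewrite -{1}(fineK qf) lte_fin.
- move=> L mL; rewrite qE//; apply: ge0_ae_eq_integral => //.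
  + exact: measurable_funTS.
  + apply/measurable_funTS/measurable_EFinP.
    by apply: measurableT_comp => //; exact: measurable_fine.
  + by move=> t _; rewrite lee_fin fine_ge0.
  + by apply: filterS q_fin => t qf _ /=; rewrite fineK.
Qed.

End transition_density.

(** * Probabilities with density proportional to an indicator plus a positive constant *)

Section tilted_probability.
Context {R : realType} {d : measure_display} {Omega : measurableType d}.
Variables (P : probability Omega R) (F : set Omega) (mF : measurable F).
Variables (e : R) (e_gt0 : 0 < e).
Local Open Scope ereal_scope.

Definition tilt_weight : {measure set Omega -> \bar R} :=
  measure_add (mrestr P mF) (mscale (NngNum (ltW e_gt0)) P).

(** The last argument [P] is only the default for a total mass that is zero or infinite; here the
    mass is [tilt_const], positive and finite. *)
Definition tilt : probability Omega R := mnormalize tilt_weight P.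

Definition tilt_const : R := fine (P F) + e.

Lemma tilt_const_gt0 : (0 < tilt_const)%R.
Proof. by rewrite ltr_wpDl// fine_ge0. Qed.

Lemma tilt_constE : tilt_const%:E = P F + e%:E.
Proof. by rewrite EFinD fineK// fin_num_measure. Qed.

Lemma tilt_weightE V : tilt_weight V = P (V `&` F) + e%:E * P V.
Proof. exact: measure_addE. Qed.

Lemma tiltE U : measurable U ->
  tilt U = (P (U `&` F) + e%:E * P U) * (tilt_const^-1)%:E.
Proof.
move=> mU; have wT : tilt_weight setT = tilt_const%:E.
  by rewrite tilt_weightE setTI probability_setT mule1 tilt_constE.
rewrite -[tilt U]/(mnormalize tilt_weight P U) /mnormalize wT.
by rewrite eqe gt_eqF ?tilt_const_gt0//= tilt_weightE.
Qed.

Lemma integral_mrestr (D : set Omega) (f : Omega -> \bar R) :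
  measurable D -> measurable_fun setT f -> (forall w, 0 <= f w) ->
  \int[mrestr P mF]_(w in D) f w = \int[P]_(w in D `&` F) f w.
Proof.
move=> mD mf f0; rewrite -{1}(setUIDK D F) ge0_integral_setU//; last 4 first.
- exact: measurableI.
- exact: measurableD.
- exact: (measurable_funTS mf).
- by apply/disj_setPS => w -[[_ Fw] [_ nFw]].
rewrite [X in _ + X]null_set_integral ?adde0//.
- apply: eq_measure_integral => A mA ADF /=; rewrite /mrestr setIidl//.
  by move=> w /ADF[].
- exact: measurableD.
- exact: (measurable_funTS mf).
- by rewrite /= /mrestr setDE -setIA setICl setI0 measure0.
Qed.

Lemma integral_tilt (D : set Omega) (f : Omega -> \bar R) :
  measurable D -> measurable_fun setT f -> (forall w, 0 <= f w) ->
  \int[tilt]_(w in D) f w =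
    (\int[P]_(w in D `&` F) f w + e%:E * \int[P]_(w in D) f w)
    * (tilt_const^-1)%:E.
Proof.
move=> mD mf f0.
have c0 : (0 <= tilt_const^-1)%R by rewrite invr_ge0 ltW// tilt_const_gt0.
rewrite (@eq_measure_integral _ _ _ _ (mscale (NngNum c0) tilt_weight)).
  rewrite ge0_integral_mscale//=; last exact: measurable_funTS.
  rewrite ge0_integral_measure_add//=; last exact: measurable_funTS.
  rewrite ge0_integral_mscale//=; last exact: measurable_funTS.
  by rewrite integral_mrestr// muleC.
move=> A mA _; rewrite [LHS]tiltE// muleC.
by rewrite -[RHS]/((tilt_const^-1)%:E * tilt_weight A) tilt_weightE.
Qed.

(** Dropping the nonnegative contribution of [e * P] leaves the integral over [F]; the normalising
    constant reappears as [P F + e]. Letting [e] tend to 0 later removes the excess. *)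
Lemma integral_tilt_le (f : Omega -> \bar R) (K : R) :
  measurable_fun setT f -> (forall w, 0 <= f w) ->
  \int[tilt]_w f w <= K%:E ->
  \int[P]_(w in F) f w <= K%:E * (P F + e%:E).
Proof.
move=> mf f0; rewrite integral_tilt// setTI -tilt_constE.
rewrite -lee_pdivlMr ?invr_gt0 ?tilt_const_gt0// => h.
apply: le_trans (le_trans h _); last by rewrite invrK.
by rewrite leeDl// mule_ge0 ?lee_fin ?(ltW e_gt0)// integral_ge0.
Qed.

End tilted_probability.

(** * From bounds on events to bounds with nonnegative weights *)

Section weighted_integral.
Import HBNNSimple.

(** Approximation of [h] by simple functions: the hypothesis applies to their level sets, linearity
    gives the bound for simple weights, and monotone convergence gives it for [h]. *)
Lemma ge0_weighted_integral_le {R : realType} {d : measure_display}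
    {Omega : measurableType d} (P : {measure set Omega -> \bar R})
    (A : set (set Omega)) (f : Omega -> R) (h : Omega -> R) (K : R) :
  (<<s A >> `<=` measurable) ->
  measurable_fun setT f -> (forall w, 0 <= f w) -> 0 <= K ->
  (forall F, <<s A >> F -> (\int[P]_(w in F) (f w)%:E <= K%:E * P F)%E) ->
  measurable_fun (setT : set (g_sigma_algebraType A)) h ->
  (forall w, 0 <= h w) ->
  (\int[P]_w ((h w)%:E * (f w)%:E) <= K%:E * \int[P]_w (h w)%:E)%E.
Proof.
move=> subA mf f0 K0 fK mh h0.
have mf' : measurable_fun setT (fun w => (f w)%:E) by exact/measurable_EFinP.
have mh' : measurable_fun (setT : set (g_sigma_algebraType A)) (fun w => (h w)%:E).
  exact/measurable_EFinP.
have f0' w : (0 <= (f w)%:E)%E by rewrite lee_fin.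
have sub_meas (u : Omega -> R) :
    measurable_fun (setT : set (g_sigma_algebraType A)) u ->
    measurable_fun (setT : set Omega) u.
  by move=> mu _ Y mY; apply: subA; exact: mu.
(* The approximation is made in the smaller sigma-algebra, so that level sets lie in [<<s A >>]. The
   [u n] are kept as plain functions because they are integrated over the larger one. *)
have [u [mu u_ge0 u_fin u_nd u_cvg]] : exists u : nat -> Omega -> R,
    [/\
        forall n, measurable_fun (setT : set (g_sigma_algebraType A)) (u n),
        forall n w, 0 <= u n w,
        forall n, finite_set (range (u n)),
        forall w m n, (m <= n)%N -> u m w <= u n w &
        forall w, (forall n, u n w <= h w) /\ EFin \o (u ^~ w) @ \oo --> (h w)%:E].
  pose h_ := nnsfun_approx measurableT mh'.
  exists (fun n w => (h_ n : g_sigma_algebraType A -> R) w); split => //.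
  - by move=> n; exact: (@fimfunP _ _ (h_ n)).
  - by move=> w m n mn; have /lefP := nd_nnsfun_approx measurableT mh' mn; apply.
  - move=> w; split => [n|]; last first.
      by apply: cvg_nnsfun_approx => // x _; rewrite lee_fin.
    rewrite nnsfun_approxE -lee_fin.
    by apply: (@le_approx _ _ _ setT (fun w => (h w)%:E)) => // x _; rewrite lee_fin.
have mu' n := sub_meas _ (mu n).
have mF n r : <<s A >> (u n @^-1` [set r]).
  by rewrite -[X in <<s A >> X]setTI; exact: mu.
have uE n w : u n w = \sum_(y \in range (u n)) (y * \1_(u n @^-1` [set y]) w).
  have uw : range (u n) (u n w) by exists w.
  rewrite (fsbigD1 (u n w))//= indicE mem_set// mulr1 fsbig1 ?addr0//.
  by move=> y [_ /= /nesym yw]; rewrite indicE memNset ?mulr0.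
have u_pos n y : range (u n) y -> 0 <= y by move=> [w _ <-].
pose v n y w := (y * \1_(u n @^-1` [set y]) w)%:E.
have v_ge0 n y w : (0 <= v n y w)%E.
  rewrite lee_fin indicE.
  have [/set_mem/= <-|_] := boolP (w \in _); last by rewrite mulr0.
  by rewrite mulr1.
have mv n y : measurable_fun (setT : set Omega) (v n y).
  apply/measurable_EFinP; apply: measurable_funM => //.
  exact/measurable_indic/subA.
have uvE n w : (u n w)%:E = (\sum_(y \in range (u n)) v n y w)%E.
  by rewrite uE fsumEFin.
have step_indic n y : range (u n) y ->
    (\int[P]_w (v n y w * (f w)%:E) <= K%:E * \int[P]_w v n y w)%E.
  move=> /u_pos y0; have mFy := subA _ (mF n y).
  have vE w : v n y w = (y%:E * (\1_(u n @^-1` [set y]) w)%:E)%E by [].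
  under eq_integral do rewrite vE -muleA.
  under [X in (_ <= _ * X)%E]eq_integral do rewrite vE.
  have m1 : measurable_fun (setT : set Omega)
      (fun w => (\1_(u n @^-1` [set y]) w : R)%:E).
    exact/measurable_EFinP/measurable_indic.
  rewrite !ge0_integralZl//.
  - rewrite integral_indic// setIT muleCA lee_wpmul2l//.
    apply: le_trans (fK _ (mF n y)).
    rewrite [leRHS]integral_mkcond epatch_indic.
    by apply: ge0_le_integral => //; [move=> w _; rewrite mule_ge0// lee_fin
      |exact: emeasurable_funM|exact: emeasurable_funM
      |move=> w _; rewrite muleC].
  - exact: emeasurable_funM.
  - by move=> w _; rewrite mule_ge0// lee_fin.
have step n : (\int[P]_w ((u n w)%:E * (f w)%:E) <= K%:E * \int[P]_w (u n w)%:E)%E.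
  under eq_integral do rewrite uvE ge0_mule_fsuml//.
  under [X in (_ <= _ * X)%E]eq_integral do rewrite uvE.
  rewrite !ge0_integral_fsum//.
  - rewrite ge0_mule_fsumr; last by move=> y; exact: integral_ge0.
    by apply: lee_fsum => // y yu; exact: step_indic.
  - by move=> y; exact: emeasurable_funM.
  - by move=> y w _; rewrite mule_ge0.
have umul w : ((h w)%:E * (f w)%:E)%E = limn (fun n => (u n w)%:E * (f w)%:E)%E.
  by apply/esym/cvg_lim => //; apply: cvgeZr => //; exact: (u_cvg w).2.
under eq_integral do rewrite umul.
rewrite monotone_convergence//.
- apply: lime_le.
    apply: ereal_nondecreasing_is_cvgn => m n mn; apply: ge0_le_integral => //.
    + by move=> w _; rewrite mule_ge0// lee_fin.
    + by apply: emeasurable_funM => //; exact/measurable_EFinP.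
    + by apply: emeasurable_funM => //; exact/measurable_EFinP.
    + by move=> w _; rewrite lee_wpmul2r// lee_fin u_nd.
  apply: nearW => n; apply: le_trans (step n) _; apply: lee_wpmul2l => //.
  apply: ge0_le_integral => //.
  + by move=> w _; rewrite lee_fin.
  + exact/measurable_EFinP.
  + exact/measurable_EFinP/sub_meas.
  + by move=> w _; rewrite lee_fin (u_cvg w).1.
- by move=> n; apply: emeasurable_funM => //; exact/measurable_EFinP.
- by move=> n w _; rewrite mule_ge0// lee_fin.
- by move=> w _ m n mn; rewrite lee_wpmul2r// lee_fin u_nd.
Qed.

End weighted_integral.

(** * Markov chains with equivalent initial law, and conditioning on the past *)

Section markov_chains.
Context {R : realType} {d : measure_display} {T : measurableType d}.
Variable mu : {sigma_finite_measure set T -> \bar R}.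
Variable G : R.-pker T ~> T.

Definition admissible_chain (dO : measure_display) (Omega : measurableType dO)
    (P : probability Omega R) (theta : nat -> Omega -> T) : Prop :=
  exists2 nu0, initial_density mu nu0 & is_markov_chain mu G nu0 P theta.

Definition shift_chain (Omega : Type) m (theta : nat -> Omega -> T) :=
  fun k => theta (m + k)%N.

(** The family generating [natural_filtration theta k]. Naming it lets [g_sigma_algebraType] express
    measurability with respect to the past as an ordinary [measurable_fun]. *)
Definition past_generator (Omega : Type) (theta : nat -> Omega -> T) (k : nat) :
    set (set Omega) :=
  \bigcup_(i in [set i | (i <= k)%N])
    preimage_set_system setT (theta i) measurable.

Section past.
Context (dO : measure_display) (Omega : measurableType dO).
Variable theta : nat -> Omega -> T.

Lemma natural_filtration_mono j k : (j <= k)%N ->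
  natural_filtration theta j `<=` natural_filtration theta k.
Proof.
move=> jk; apply: sub_sigma_algebra2 => F [i /= ij iF]; exists i => //=.
exact: leq_trans jk.
Qed.

Lemma natural_filtration_measurable k :
  (forall i, measurable_fun setT (theta i)) ->
  natural_filtration theta k `<=` measurable.
Proof.
move=> mtheta; apply: smallest_sub; first exact: sigma_algebra_measurable.
by move=> _ [i _ [Y mY <-]]; exact: mtheta.
Qed.

Lemma natural_filtration_shift m k :
  natural_filtration (shift_chain m theta) k
    `<=` natural_filtration theta (m + k).
Proof.
apply: sub_sigma_algebra2 => F [i /= ik iF]; exists (m + i)%N => //=.
by rewrite leq_add2l.
Qed.

Lemma past_measurable_theta j k : (j <= k)%N ->
  measurable_fun (setT : set (g_sigma_algebraType (past_generator theta k)))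
    (theta j).
Proof.
move=> jk _ Y mY; apply: sub_sigma_algebra.
by exists j => //; exists Y.
Qed.

End past.

Variable g : T * T -> R.
Hypothesis g_measurable : measurable_fun setT g.
Hypothesis g_ge0 : forall l t, 0 <= g (l, t).
Hypothesis G_density : forall l L, measurable L ->
  G l L = (\int[mu]_(t in L) (g (l, t))%:E)%E.
Hypothesis g_pos : {ae mu, forall l, (0 < \int[mu]_t (g (t, l))%:E)%E}.

Section chain.
Context (dO : measure_display) (Omega : measurableType dO).
Variables (P : probability Omega R) (theta : nat -> Omega -> T).
Hypothesis thetaP : admissible_chain P theta.

Lemma chain_measurable k : measurable_fun setT (theta k).
Proof. by case: thetaP => ? _ []. Qed.

(** Induction on time: equivalence of the law at time [k] with [mu] is what [transition_density]
    needs to produce a positive density at time [k.+1]. Essential bounds in [mu] thus hold almost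
    surely along the chain. *)
Lemma chain_law_null k N : measurable N ->
  P (theta k @^-1` N) = 0%E <-> mu N = 0%E.
Proof.
case: thetaP => nu0 nu0P [mtheta theta0 thetaS].
elim: k N => [|k IHk] N mN; first by rewrite theta0//; exact: initial_density_null.
have [nu nuP nuE] := transition_density g_measurable g_ge0 G_density g_pos
  (mtheta k) (fun N mN => (IHk N mN).1).
rewrite -(initial_density_null nuP mN) -nuE//.
rewrite -[theta k.+1 @^-1` N]setTI thetaS//.
exact: (@measurableT _ (g_sigma_algebraType (past_generator theta k))).
Qed.

(* A change of measure depending on the past up to time [j] preserves the kernel
   from time [j] on; the term [e * P] in the tilt keeps the new initial density
   positive. *)
Lemma admissible_chain_tilt j F (mF : measurable F) (e : R) (e_gt0 : 0 < e) :
  natural_filtration theta j F ->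
  admissible_chain (tilt P mF e_gt0) (shift_chain j.+1 theta).
Proof.
case: thetaP => nu0 nu0P [mtheta theta0 thetaS] jF.
have mG k L : measurable L -> measurable_fun setT (fun w => G (theta k w) L).
  by move=> mL; apply: (measurableT_comp (measurable_kernel G _ mL)).
(* From time [j] on, intersecting with [F] stays inside the filtration, so the one-step identity
   holds under [P] both on [D] and on its intersection with [F], hence under their combination. *)
have step k D L : (j <= k)%N -> natural_filtration theta k D -> measurable L ->
    tilt P mF e_gt0 (D `&` theta k.+1 @^-1` L) =
    (\int[tilt P mF e_gt0]_(w in D) G (theta k w) L)%E.
  move=> jk kD mL; have mD : measurable D.
    exact: natural_filtration_measurable kD.
  have mDL : measurable (D `&` theta k.+1 @^-1` L).
    by apply: measurableI => //; rewrite -[X in measurable X]setTI; exact: mtheta.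
  have kF := natural_filtration_mono jk jF.
  have kDF : natural_filtration theta k (D `&` F).
    exact: (@measurableI _ (g_sigma_algebraType (past_generator theta k))).
  rewrite tiltE// integral_tilt//; last exact: mG.
  by rewrite setIAC !thetaS.
have [nu nuP nuE] : exists2 nu, initial_density mu nu &
    forall L, measurable L -> (\int[tilt P mF e_gt0]_w G (theta j w) L =
      \int[mu]_(l in L) (nu l)%:E)%E.
  apply: (transition_density g_measurable) => // N mN tN.
  apply/(chain_law_null j mN).
  have mjN : measurable (theta j @^-1` N).
    by rewrite -[X in measurable X]setTI; exact: mtheta.
  (* A null event of the tilt is [P]-null, because the summand [e * P] vanishes on it and [e] is
     positive. *)
  apply/eqP; move/eqP: tN; rewrite tiltE// mule_eq0 eqe invr_eq0.
  rewrite (gt_eqF (tilt_const_gt0 P F e_gt0)) orbF.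
  rewrite padde_eq0 ?mule_ge0 ?lee_fin ?(ltW e_gt0)//.
  by move=> /andP[_]; rewrite mule_eq0 eqe (gt_eqF e_gt0).
exists nu => //; split => [k|L mL|k D L kD mL].
- exact: mtheta.
- rewrite -nuE// /shift_chain addn0 -[_ @^-1` _]setTI step//.
  exact: (@measurableT _ (g_sigma_algebraType (past_generator theta j))).
- rewrite /shift_chain addnS; apply: step => //; first by rewrite addSn leqW// leq_addr.
  exact: natural_filtration_shift.
Qed.

(** A substitute for bounding the conditional expectation of [f] given the past up to [j] by [K].
    The tilts yield the bound on each past event up to an error [K * e]; after [e] tends to 0,
    events are replaced by weights. *)
Lemma chain_integral_le j (f : Omega -> R) (h : Omega -> R) (K : R) :
  measurable_fun setT f -> (forall w, 0 <= f w) -> 0 <= K ->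
  (forall Q : probability Omega R, admissible_chain Q (shift_chain j.+1 theta) ->
    (\int[Q]_w (f w)%:E <= K%:E)%E) ->
  measurable_fun (setT : set (g_sigma_algebraType (past_generator theta j))) h ->
  (forall w, 0 <= h w) ->
  (\int[P]_w ((h w)%:E * (f w)%:E) <= K%:E * \int[P]_w (h w)%:E)%E.
Proof.
move=> mf f0 K0 fK.
have mf' : measurable_fun setT (fun w => (f w)%:E) by exact/measurable_EFinP.
have f0' w : (0 <= (f w)%:E)%E by rewrite lee_fin.
apply: ge0_weighted_integral_le => //.
  exact: (natural_filtration_measurable chain_measurable).
move=> F jF.
have mF : measurable F := natural_filtration_measurable chain_measurable jF.
apply/lee_addgt0Pr => e e0.
have K1 : 0 < K + 1 by rewrite ltr_wpDl.
(* With this parameter the error [K * (e / (K + 1))] is at most [e]; the denominator [K + 1] also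
   covers [K = 0]. *)
have e'0 : 0 < e / (K + 1) by rewrite divr_gt0.
have := integral_tilt_le mf' f0' (fK _ (admissible_chain_tilt mF e'0 jF)).
move/le_trans; apply; rewrite muleDr//; last by rewrite fin_num_adde_defl.
rewrite leeD2l// -EFinM lee_fin mulrCA ler_piMr ?(ltW e0)//.
by rewrite ler_pdivrMr// mul1r lerDl.
Qed.

End chain.
End markov_chains.

(** * Mean-square estimates along a chain *)

Section measurable_matrices.
Context {R : realType} {d : measure_display} {X : measurableType d}.

Definition measurable_mx n m (M : X -> 'M[R]_(n, m)) : Prop :=
  forall i j, measurable_fun setT (fun l => M l i j).

Lemma measurable_mx_cst n m (M : 'M[R]_(n, m)) : measurable_mx (fun=> M).
Proof. by move=> i j; exact: measurable_cst. Qed.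

Lemma measurable_mxD n m (M N : X -> 'M[R]_(n, m)) :
  measurable_mx M -> measurable_mx N -> measurable_mx (fun l => M l + N l).
Proof.
move=> mM mN i j.
rewrite (_ : (fun _ => _) = (fun l => M l i j + N l i j)).
  exact: measurable_funD.
by apply/funext => l; rewrite mxE.
Qed.

Lemma measurable_mxM n m p (M : X -> 'M[R]_(n, m)) (N : X -> 'M[R]_(m, p)) :
  measurable_mx M -> measurable_mx N -> measurable_mx (fun l => M l *m N l).
Proof.
move=> mM mN i j.
rewrite (_ : (fun _ => _) = (fun l => \sum_k M l i k * N l k j)).
  by apply: measurable_sum => k; exact: measurable_funM.
by apply/funext => l; rewrite mxE.
Qed.

Lemma measurable_sqr_enorm n (x : X -> 'cV[R]_n) :
  measurable_mx x -> measurable_fun setT (fun l => enorm (x l) ^+ 2).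
Proof.
move=> mx; rewrite (_ : (fun _ => _) = (fun l => \sum_i x l i 0 ^+ 2)).
  by apply: measurable_sum => i; exact: measurable_funX.
by apply/funext => l; rewrite sqr_enorm.
Qed.

End measurable_matrices.

Lemma measurable_mx_comp {R : realType} d d' (X : measurableType d)
    (Y : measurableType d') n m (M : X -> 'M[R]_(n, m)) (f : Y -> X) :
  measurable_mx M -> measurable_fun setT f -> measurable_mx (fun y => M (f y)).
Proof. by move=> mM mf i j; exact: (measurableT_comp (mM i j)). Qed.

(** * Mean-square norms of random vectors *)

Section mean_square.
Context {R : realType} {d : measure_display} {Omega : measurableType d}.
Variable P : probability Omega R.
Local Open Scope ereal_scope.

Definition msq n (x : Omega -> 'cV[R]_n) : \bar R :=
  \int[P]_w (enorm (x w) ^+ 2)%:E.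

Lemma msqE n (x : Omega -> 'cV[R]_n) : msq x = 'E_P[fun w => (enorm (x w) ^+ 2)%R].
Proof. by rewrite unlock. Qed.

Lemma msq_ge0 n (x : Omega -> 'cV[R]_n) : 0 <= msq x.
Proof. by apply: integral_ge0 => w _; rewrite lee_fin sqr_ge0. Qed.

Lemma msq_cst n (x : 'cV[R]_n) : msq (fun=> x) = (enorm x ^+ 2)%:E.
Proof.
rewrite /msq (_ : (fun _ => _) = cst (enorm x ^+ 2)%:E)//.
rewrite integral_cst// -[RHS]mule1; congr (_ * _).
exact: probability_setT.
Qed.

Lemma measurable_msq n (x : Omega -> 'cV[R]_n) : measurable_mx x ->
  measurable_fun setT (fun w => (enorm (x w) ^+ 2)%:E).
Proof. by move=> mx; apply/measurable_EFinP; exact: measurable_sqr_enorm. Qed.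

Lemma msq_ae_le n m (x : Omega -> 'cV[R]_n) (y : Omega -> 'cV[R]_m) (c : R) :
  measurable_mx x -> measurable_mx y -> (0 <= c)%R ->
  {ae P, forall w, (enorm (x w) ^+ 2 <= c * enorm (y w) ^+ 2)%R} ->
  msq x <= c%:E * msq y.
Proof.
move=> mx my c0 xy; rewrite /msq -ge0_integralZl//; last 2 first.
- exact: measurable_msq.
- by move=> w _; rewrite lee_fin sqr_ge0.
apply: ae_ge0_le_integral => //.
- by move=> w _; rewrite lee_fin sqr_ge0.
- exact: measurable_msq.
- by move=> w _; rewrite mule_ge0// lee_fin sqr_ge0.
- by apply: emeasurable_funM => //; exact: measurable_msq.
- by apply: filterS xy => w xyw _; rewrite -EFinM lee_fin.
Qed.

Lemma msqD_young n (e : R) (x y : Omega -> 'cV[R]_n) :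
  (0 < e)%R -> measurable_mx x -> measurable_mx y ->
  msq (fun w => x w + y w)%R <=
    (1 + e)%:E * msq x + (1 + e^-1)%:E * msq y.
Proof.
move=> e0 mx my.
have e1 : (0 <= 1 + e)%R by rewrite addr_ge0// ltW.
have e2 : (0 <= 1 + e^-1)%R by rewrite addr_ge0// invr_ge0 ltW.
have mx2 := measurable_msq mx.
have my2 := measurable_msq my.
rewrite /msq -!ge0_integralZl//; try by [rewrite lee_fin |
  move=> w _; rewrite lee_fin sqr_ge0].
rewrite -ge0_integralD//; last 4 first.
- by move=> w _; rewrite mule_ge0// lee_fin// sqr_ge0.
- exact: emeasurable_funM.
- by move=> w _; rewrite mule_ge0// lee_fin// sqr_ge0.
- exact: emeasurable_funM.
apply: ge0_le_integral => //.
- by move=> w _; rewrite lee_fin sqr_ge0.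
- by apply: measurable_msq; exact: measurable_mxD.
- by apply: emeasurable_funD; exact: emeasurable_funM.
- by move=> w _; rewrite -!EFinM -EFinD lee_fin sqr_enormD_young.
Qed.

End mean_square.

(** * State transition matrices *)

Section transition_matrix.
Context {R : realType} {d : measure_display} {T : measurableType d}.
Context {Omega : Type} {n : nat}.

Fixpoint transition (A : T -> 'M[R]_n) (theta : nat -> Omega -> T) (k : nat)
    (w : Omega) : 'M[R]_n :=
  if k is j.+1 then A (theta j w) *m transition A theta j w else 1%:M.

Lemma free_stateE A theta (x0 : 'cV[R]_n) k w :
  free_state A theta x0 k w = transition A theta k w *m x0.
Proof.
by elim: k => [|k IHk] /=; [rewrite mul1mx|rewrite IHk mulmxA].
Qed.

(** Cocycle identity: the left factor sees only the chain from time [k] on, the right factor only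
    the earlier states, which is the separation needed for restarting. *)
Lemma transition_add A theta k m w :
  transition A theta (k + m) w =
  transition A (shift_chain k theta) m w *m transition A theta k w.
Proof.
elim: m => [|m IHm]; first by rewrite addn0 /= mul1mx.
by rewrite addnS /= IHm mulmxA.
Qed.

End transition_matrix.

Section transition_measurability.
Context {R : realType} {d : measure_display} {T : measurableType d}.
Context {dO : measure_display} {Omega : measurableType dO} {n : nat}.
Variables (A : T -> 'M[R]_n) (theta : nat -> Omega -> T).
Hypothesis mA : measurable_mx A.

Lemma measurable_transition k :
  (forall i, measurable_fun setT (theta i)) ->
  measurable_mx (transition A theta k).
Proof.
move=> mtheta; elim: k => [|k IHk] /=; first exact: measurable_mx_cst.
by apply: measurable_mxM => //; exact: (measurable_mx_comp mA).
Qed.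

(** The product up to time [k] involves the chain only up to [k - 1], so [k = j.+1] is still
    determined by the past up to [j]. *)
Lemma past_measurable_transition j k : (k <= j.+1)%N ->
  @measurable_mx R _ (g_sigma_algebraType (past_generator theta j)) n n
    (transition A theta k).
Proof.
elim: k => [|k IHk] kj /=; first exact: measurable_mx_cst.
apply: measurable_mxM; last by apply: IHk; exact: ltnW.
exact: (measurable_mx_comp mA (past_measurable_theta (theta := theta) (kj : (k <= j)%N))).
Qed.

End transition_measurability.

(** * Restarting from a random state, and stability from summability *)

Section chain_estimates.
Context {R : realType} {d : measure_display} {T : measurableType d}.
Variable mu : {sigma_finite_measure set T -> \bar R}.
Variable G : R.-pker T ~> T.
Variable g : T * T -> R.
Hypothesis g_measurable : measurable_fun setT g.
Hypothesis g_ge0 : forall l t, 0 <= g (l, t).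
Hypothesis G_density : forall l L, measurable L ->
  G l L = (\int[mu]_(t in L) (g (l, t))%:E)%E.
Hypothesis g_pos : {ae mu, forall l, (0 < \int[mu]_t (g (t, l))%:E)%E}.

Section one_chain.
Context {dO : measure_display} {Omega : measurableType dO}.
Variables (P : probability Omega R) (theta : nat -> Omega -> T).
Hypothesis thetaP : admissible_chain mu G P theta.

Lemma chain_ae (p : T -> Prop) k :
  {ae mu, forall l, p l} -> {ae P, forall w, p (theta k w)}.
Proof.
move=> [N [mN muN0 pN]]; exists (theta k @^-1` N); split.
- by rewrite -[X in measurable X]setTI; exact: (chain_measurable thetaP).
- by apply/(chain_law_null g_measurable g_ge0 G_density g_pos thetaP k mN).
- by move=> w /= npw; apply: pN.
Qed.

Lemma msq_mulmx_le n m (M : T -> 'M[R]_(n, m)) (x : Omega -> 'cV[R]_m) k (c : R) :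
  measurable_mx M -> measurable_mx x ->
  {ae mu, forall l, spectral_norm (M l) <= c} ->
  (msq P (fun w => M (theta k w) *m x w) <= (c ^+ 2)%:E * msq P x)%E.
Proof.
move=> mM mx Mc; apply: msq_ae_le => //; last 2 first.
- exact: sqr_ge0.
- apply: filterS (chain_ae k Mc) => w; exact: sqr_enorm_mulmx_le.
apply: measurable_mxM => //; apply: (measurable_mx_comp mM).
exact: (chain_measurable thetaP).
Qed.

(* The squared coordinates of [xi] serve as weights depending on the past only;
   treating them separately costs the factor [n]. *)
Lemma msq_random_vector_le n p N j (M : nat -> Omega -> 'M[R]_(p, n))
    (xi : Omega -> 'cV[R]_n) (K : R) :
  0 <= K -> (forall k, measurable_mx (M k)) ->
  @measurable_mx R _ (g_sigma_algebraType (past_generator theta j)) n 1 xi ->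
  (forall Q : probability Omega R,
    admissible_chain mu G Q (shift_chain j.+1 theta) ->
    forall x0 : 'cV[R]_n,
    (\sum_(k < N) msq Q (fun w => M k w *m x0) <= (K * enorm x0 ^+ 2)%:E)%E) ->
  (\sum_(k < N) msq P (fun w => M k w *m xi w) <= (n%:R * K)%:E * msq P xi)%E.
Proof.
move=> K0 mM pxi MK.
have mtheta := chain_measurable thetaP.
have mxi : measurable_mx xi.
  move=> i j' _ Y mY; apply: (natural_filtration_measurable mtheta (k := j)).
  exact: pxi.
pose f i w := \sum_(k < N) enorm (M k w *m delta_mx i 0) ^+ 2 : R.
have mMd k i : measurable_mx (fun w => M k w *m (delta_mx i 0 : 'cV[R]_n)).
  by apply: measurable_mxM => //; exact: measurable_mx_cst.
have f_ge0 i w : 0 <= f i w by apply: sumr_ge0 => k _; exact: sqr_ge0.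
have mf i : measurable_fun setT (f i).
  by apply: measurable_sum => k; exact: measurable_sqr_enorm.
have msqE' (Q : probability Omega R) (y : nat -> Omega -> 'cV[R]_p) :
    (forall k, measurable_mx (y k)) ->
    (\sum_(k < N) msq Q (y k) = \int[Q]_w (\sum_(k < N) enorm (y k w) ^+ 2)%:E)%E.
  move=> my; under [RHS]eq_integral do rewrite -sumEFin.
  rewrite ge0_integral_sum//.
  - by move=> k; exact: measurable_msq.
  - by move=> k w _; rewrite lee_fin sqr_ge0.
have fK i : (\int[P]_w ((xi w i 0 ^+ 2)%:E * (f i w)%:E) <=
             K%:E * \int[P]_w (xi w i 0 ^+ 2)%:E)%E.
  apply: (chain_integral_le g_measurable g_ge0 G_density g_pos thetaP (j := j)) => //.
  - move=> Q QP; rewrite -(msqE' Q (fun k w => M k w *m delta_mx i 0))//.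
    by rewrite (le_trans (MK _ QP _))// enorm_delta expr1n mulr1.
  - exact: (measurable_funX _ (pxi i 0)).
  - by move=> w; exact: sqr_ge0.
rewrite (msqE' P (fun k w => M k w *m xi w)); last by move=> k; exact: measurable_mxM.
have mw i : measurable_fun setT (fun w => ((xi w i 0 ^+ 2)%:E * (f i w)%:E)%E).
  apply: emeasurable_funM; apply/measurable_EFinP => //.
  exact: measurable_funX.
have w0 i w : setT w -> (0 <= (xi w i 0 ^+ 2)%:E * (f i w)%:E)%E.
  by move=> _; rewrite mule_ge0 ?lee_fin ?sqr_ge0.
(* Expanding [xi w] in the standard basis and applying [sqr_enorm_sum] separates the past weights
   [xi w i 0 ^+ 2] from the energies [f i w] generated by basis vectors. *)
apply: (@le_trans _ _ (\int[P]_w (n%:R%:E *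
    \sum_(i < n) ((xi w i 0 ^+ 2)%:E * (f i w)%:E)))%E).
  apply: ge0_le_integral => //.
  - by move=> w _; rewrite lee_fin sumr_ge0// => k _; exact: sqr_ge0.
  - apply/measurable_EFinP; apply: measurable_sum => k.
    by apply: measurable_sqr_enorm; exact: measurable_mxM.
  - by apply: emeasurable_funM => //; exact: emeasurable_sum.
  - move=> w _.
    have -> : (\sum_(i < n) ((xi w i 0 ^+ 2)%:E * (f i w)%:E) =
        (\sum_(i < n) xi w i 0 ^+ 2 * f i w)%:E)%E by rewrite -sumEFin.
    rewrite -EFinM lee_fin.
    have -> : \sum_(i < n) xi w i 0 ^+ 2 * f i w =
        \sum_(k < N) \sum_(i < n) enorm (M k w *m (xi w i 0 *: delta_mx i 0)) ^+ 2.
      rewrite exchange_big/=; apply: eq_bigr => i _; rewrite mulr_sumr.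
      by apply: eq_bigr => k _; rewrite -scalemxAr sqr_enormZ.
    rewrite mulr_sumr; apply: ler_sum => k _.
    by rewrite {1}(colE (xi w)) mulmx_sumr; exact: sqr_enorm_sum.
rewrite ge0_integralZl//; last 2 first.
- exact: emeasurable_sum.
- by move=> w _; apply: sume_ge0 => i _; exact: w0.
rewrite ge0_integral_sum// EFinM -muleA lee_wpmul2l//.
have -> : msq P xi = (\sum_(i < n) \int[P]_w (xi w i 0 ^+ 2)%:E)%E.
  under [LHS]eq_integral do rewrite sqr_enorm -sumEFin.
  rewrite ge0_integral_sum//.
  - by move=> i; apply/measurable_EFinP; exact: measurable_funX.
  - by move=> i w _; rewrite lee_fin sqr_ge0.
rewrite ge0_sume_distrr; last first.
  by move=> i _; apply: integral_ge0 => w _; rewrite lee_fin sqr_ge0.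
by apply: lee_sum => i _; exact: fK.
Qed.

End one_chain.

Lemma Hinf_bound n m (M : T -> 'M[R]_(n, m)) : Hinf mu M ->
  exists2 c, 0 <= c & {ae mu, forall l, spectral_norm (M l) <= c}.
Proof.
move=> [_]; rewrite /Hinf_norm => Moo.
have Mle := ess_sup_ge mu (fun l => (spectral_norm (M l))%:E).
move: Moo Mle; case: (ess_sup _ _) => [c _|//|_] Mle.
- exists (Num.max 0 c); first by rewrite le_max lexx.
  apply: filterS Mle => l; rewrite lee_fin => /le_trans; apply.
  by rewrite le_max lexx orbT.
(* Essential supremum [-oo]: a real number below [-oo] is absurd, so any bound holds wherever this
   inequality does. *)
- by exists 0 => //; apply: filterS Mle => l; rewrite leeNy_eq.
Qed.

(* Datko's argument: the tail sums [T k] satisfy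
   [T k.+1 = T k - q k <= (1 - K^-1) * T k]. *)
Lemma geometric_decay_of_tail_sums (q : nat -> R) (K : R) : 1 < K ->
  (forall k N, \sum_(m < N) q (k + m)%N <= K * q k) ->
  forall k, q k <= K * (1 - K^-1) ^+ k * q 0%N.
Proof.
move=> K1 qK k; have K0 : 0 < K := lt_trans ltr01 K1.
have a0 : 0 <= 1 - K^-1 by rewrite subr_ge0 invf_le1// ltW.
(* The induction carries the bound for whole tail sums of any length; length 1 gives the claim. *)
suff tail N : \sum_(m < N) q (k + m)%N <= K * (1 - K^-1) ^+ k * q 0%N.
  by have := tail 1%N; rewrite big_ord1 addn0.
elim: k N => [|k IHk] N; first by rewrite expr0 mulr1.
have := IHk N.+1; have := qK k N.+1.
rewrite !big_ord_recl/= addn0.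
under eq_bigr do rewrite /bump/= add1n addnS -addSn.
set t := \sum_(_ < N) _ => qkt tle.
rewrite exprSr mulrAC mulrA -[leLHS]mul1r.
apply: (@le_trans _ _ ((1 - K^-1) * (q k + t))).
  rewrite mulrBl mul1r.
  have : K^-1 * (q k + t) <= q k by rewrite mulrC ler_pdivrMr// mulrC.
  by rewrite mul1r => ?; lra.
rewrite [leRHS](_ : _ = (1 - K^-1) * (K * (1 - K^-1) ^+ k * q 0%N)); last by ring.
by rewrite ler_wpM2l.
Qed.

(** Restarting at time [j] with the random state reached there costs a factor [n], so every tail sum
    of [E|x(k)|^2] is at most a fixed multiple of its first term. Datko's argument then applies. *)
Lemma ems_stable_of_summable n (A : T -> 'M[R]_n) (M : R) :
  measurable_mx A -> 0 <= M ->
  (forall (dO : measure_display) (Omega : measurableType dO)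
     (P : probability Omega R) (theta : nat -> Omega -> T),
   admissible_chain mu G P theta -> forall (x0 : 'cV[R]_n) N,
   (\sum_(k < N) msq P (free_state A theta x0 k) <= (M * enorm x0 ^+ 2)%:E)%E) ->
  (* The constant [K] chosen below dominates [M] (tail from time 0) and [n * M] (later tails), and
     exceeds 1 even when [M = 0]. *)
  ems_stable mu G A.
Proof.
move=> mA M0 sumA; pose K := (n%:R + 1) * M + 2.
have K1 : 1 < K.
  by rewrite /K -[1 in ltLHS]add0r ler_ltD ?mulr_ge0 ?addr_ge0// ltr1n.
have K0 : 0 < K := lt_trans ltr01 K1.
exists K, (1 - K^-1); split => //.
  by rewrite subr_gt0 invf_lt1// K1 ltrBlDr ltrDl invr_gt0.
move=> nu0 dO Omega P theta x0 nu0P thetaP0 k.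
have thetaP : admissible_chain mu G P theta by exists nu0.
rewrite -msqE; pose x := free_state A theta x0; rewrite -/x.
have xE j : x j = (fun w => transition A theta j w *m x0).
  by apply/funext => w; exact: free_stateE.
have x_fin j : msq P (x j) \is a fin_num.
  rewrite ge0_fin_numE ?msq_ge0//; apply: le_lt_trans (ltry (M * enorm x0 ^+ 2)).
  apply: le_trans (sumA _ _ _ _ thetaP x0 j.+1).
  by rewrite big_ord_recr/= leeDr// sume_ge0// => i _; exact: msq_ge0.
pose q j := fine (msq P (x j)).
have qE j : (q j)%:E = msq P (x j) by rewrite fineK.
have q_ge0 j : 0 <= q j by rewrite fine_ge0// msq_ge0.
have q0 : q 0%N = enorm x0 ^+ 2.
  by apply: EFin_inj; rewrite qE -[x 0%N]/(fun=> x0) msq_cst.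
rewrite -qE lee_fin -q0; apply: geometric_decay_of_tail_sums => // j N.
(* Time 0 is separate: its state is deterministic and [sumA] applies directly, whereas a restart at
   [j.+1] conditions on the past up to [j]. *)
case: j => [|j].
  apply: (@le_trans _ _ (M * q 0%N)); last first.
    rewrite ler_wpM2r// /K mulrDl mul1r -addrA addrC -addrA lerDl.
    by rewrite addr_ge0// mulr_ge0.
  rewrite q0 -lee_fin -sumEFin; under eq_bigr do rewrite qE.
  exact: sumA.
apply: (@le_trans _ _ (n%:R * M * q j.+1)); last first.
  by rewrite ler_wpM2r// /K mulrDl -addrA lerDl addr_ge0// mul1r.
rewrite -lee_fin -sumEFin EFinM qE.
rewrite (eq_bigr (fun m : 'I_N => msq P (fun w =>
    transition A (shift_chain j.+1 theta) m w *m x j.+1 w))); last first.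
  move=> m _; rewrite qE; congr msq; apply/funext => w.
  by rewrite !xE transition_add mulmxA.
apply: (msq_random_vector_le thetaP (j := j)) => //.
- move=> m; apply: measurable_transition => // i.
  exact: (chain_measurable thetaP).
- rewrite xE; apply: measurable_mxM; last exact: measurable_mx_cst.
  exact: past_measurable_transition.
- move=> Q QP y0; apply: le_trans (sumA _ _ _ _ QP y0 N).
  rewrite le_eqVlt; apply/orP; left; apply/eqP; apply: eq_bigr => m _.
  by congr msq; apply/funext => w; rewrite free_stateE.
Qed.

End chain_estimates.

(** * Small gain *)

Lemma young_margin (R : realFieldType) (rho : R) : 0 <= rho -> rho < 1 ->
  0 < 1 - (1 + (1 - rho) / 2) * rho.
Proof.
move=> rho0 rho1.
rewrite (_ : 1 - _ = (1 - rho) * (1 - rho / 2)); last by field.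
by rewrite mulr_gt0// ?subr_gt0//; lra.
Qed.

(** Sum the recursion over [k] and absorb the [rho] term on the left. *)
Lemma sum_le_of_affine_recursion (R : realType) (s t : nat -> R) (rho : R) :
  0 <= rho -> (forall k, 0 <= s k) -> (forall k, 0 <= t k) ->
  (forall k, s k.+1 <= rho * s k + t k) ->
  forall N, (1 - rho) * \sum_(k < N) s k <= s 0%N + \sum_(k < N) t k.
Proof.
move=> rho0 s0 t0 st [|N]; first by rewrite !big_ord0 mulr0 addr0 s0.
rewrite mulrBl mul1r lerBlDr [leLHS]big_ord_recl -addrA lerD2l.
apply: (@le_trans _ _ (\sum_(k < N) (rho * s k + t k))).
  by apply: ler_sum => k _; exact: st.
rewrite big_split/= -mulr_sumr addrC !big_ord_recr/= lerD//.
  by rewrite lerDl.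
by rewrite ler_wpM2l// lerDl.
Qed.

(** * Stability of the closed loop for a perturbation of small gain *)

Section small_gain.
Context {R : realType} {d : measure_display} {T : measurableType d}.
Variable mu : {sigma_finite_measure set T -> \bar R}.
Variable G : R.-pker T ~> T.
Variable g : T * T -> R.
Hypothesis g_measurable : measurable_fun setT g.
Hypothesis g_ge0 : forall l t, 0 <= g (l, t).
Hypothesis G_density : forall l L, measurable L ->
  G l L = (\int[mu]_(t in L) (g (l, t))%:E)%E.
Hypothesis g_pos : {ae mu, forall l, (0 < \int[mu]_t (g (t, l))%:E)%E}.
Variables (n r : nat) (A : T -> 'M[R]_n) (B : T -> 'M[R]_(n, r)).
Variables (C : T -> 'M[R]_(r, n)) (D : T -> 'M[R]_r).
Hypotheses (mA : measurable_mx A) (mB : measurable_mx B).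
Hypotheses (mC : measurable_mx C) (mD : measurable_mx D).
Variables (a b c del : R).
Hypotheses (b_ge0 : 0 <= b) (c_ge0 : 0 <= c).
Hypothesis A_le : {ae mu, forall l, spectral_norm (A l) <= a}.
Hypothesis B_le : {ae mu, forall l, spectral_norm (B l) <= b}.
Hypothesis C_le : {ae mu, forall l, spectral_norm (C l) <= c}.
Hypothesis D_le : {ae mu, forall l, spectral_norm (D l) <= del}.
Variables (beta alpha : R).
Hypotheses (beta_gt0 : 0 < beta) (alpha_gt0 : 0 < alpha) (alpha_lt1 : alpha < 1).
Hypothesis A_stable : forall (dO : measure_display) (Omega : measurableType dO)
    (P : probability Omega R) (theta : nat -> Omega -> T),
  admissible_chain mu G P theta -> forall (x0 : 'cV[R]_n) k,
  (msq P (free_state A theta x0 k) <= (beta * alpha ^+ k * enorm x0 ^+ 2)%:E)%E.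
Variable gamma : R.
Hypothesis gamma_gt0 : 0 < gamma.
Hypothesis io_gain : forall (dO : measure_display) (Omega : measurableType dO)
    (P : probability Omega R) (theta : nat -> Omega -> T)
    (v : nat -> Omega -> 'cV[R]_r),
  admissible_chain mu G P theta -> l2 P theta v -> ~ l2_zero P v ->
  (l2_sqnorm P (io_operator A B C theta v) - gamma%:E * l2_sqnorm P v < 0)%E.
Hypothesis gamma_del : gamma * del ^+ 2 < 1.

Definition closed_loop l := A l + B l *m D l *m C l.

Lemma measurable_closed_loop : measurable_mx closed_loop.
Proof.
by apply: measurable_mxD => //; apply: measurable_mxM => //; exact: measurable_mxM.
Qed.

(** The feedback input is not known in advance to have finite total energy, while its truncations
    belong to [l2]. *)
Definition truncate (Omega : Type) (N : nat) (v : nat -> Omega -> 'cV[R]_r) :=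
  fun k w => if (k < N)%N then v k w else 0.

(** Causality; [k = N] is allowed because the state at time [k] depends on inputs strictly before
    [k]. *)
Lemma forced_state_truncate (Omega : Type) (theta : nat -> Omega -> T) v N k w :
  (k <= N)%N ->
  forced_state A B theta (truncate N v) k w = forced_state A B theta v k w.
Proof.
elim: k => [//|k IHk] kN /=; rewrite IHk; last exact: ltnW.
by rewrite /truncate kN.
Qed.

(* Young's inequality is used with parameters [eta1] and [eta2] small enough to keep
   [(1 + eta1) * (gamma * del ^+ 2)] and [(1 + eta2) * alpha] below 1. *)
Let eta1 := (1 - gamma * del ^+ 2) / 2.
Let eta2 := (1 - alpha) / 2.
(** Each denominator comes from moving a Young term to the left side. The factor [n] in
    [input_const] is the price of restarting from a random vector, paid through
    [msq_random_vector_le]. *)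
Let output_const := (1 + eta1^-1) * (c ^+ 2 * (beta * (1 - alpha)^-1))
  / (1 - (1 + eta1) * (gamma * del ^+ 2)).
Let input_const := (1 + eta2^-1) * (n%:R * beta * b ^+ 2).
Let closed_loop_const := (beta + input_const * (del ^+ 2 * output_const))
  / (1 - (1 + eta2) * alpha).

Section one_chain.
Context {dO : measure_display} {Omega : measurableType dO}.
Variables (P : probability Omega R) (theta : nat -> Omega -> T).
Hypothesis thetaP : admissible_chain mu G P theta.

Let mtheta := chain_measurable thetaP.

Lemma past_measurable_mx n' m' j (M : Omega -> 'M[R]_(n', m')) :
  @measurable_mx R _ (g_sigma_algebraType (past_generator theta j)) n' m' M ->
  measurable_mx M.
Proof.
move=> pM i j' _ Y mY; apply: (natural_filtration_measurable mtheta (k := j)).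
exact: pM.
Qed.

Lemma measurable_forced_state (v : nat -> Omega -> 'cV[R]_r) k :
  (forall k, measurable_mx (v k)) -> measurable_mx (forced_state A B theta v k).
Proof.
move=> mv; elim: k => [|k IHk] /=; first exact: measurable_mx_cst.
by apply: measurable_mxD; apply: measurable_mxM => //;
  [exact: (measurable_mx_comp mA)|exact: (measurable_mx_comp mB)].
Qed.

Lemma finite_horizon_gain (v : nat -> Omega -> 'cV[R]_r) N :
  (forall k, @measurable_mx R _ (g_sigma_algebraType (past_generator theta k))
               r 1 (v k)) ->
  (forall k, msq P (v k) < +oo)%E ->
  (\sum_(k < N) msq P (io_operator A B C theta v k)
     <= gamma%:E * \sum_(k < N) msq P (v k))%E.
Proof.
move=> pv v_fin; pose u := truncate N v.
have pu k : @measurable_mx R _ (g_sigma_algebraType (past_generator theta k)) r 1 (u k).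
  rewrite (_ : u k = if (k < N)%N then v k else fun=> 0).
    by case: ifP => _; [exact: pv|exact: measurable_mx_cst].
  by apply/funext => w; rewrite /u /truncate; case: ifP.
have u_norm : l2_sqnorm P u = (\sum_(k < N) msq P (v k))%E.
  rewrite /l2_sqnorm (nneseries_split 0 N); last by move=> k _; rewrite -msqE msq_ge0.
  rewrite eseries0 ?adde0.
    rewrite add0n big_mkord; apply: eq_bigr => k _; rewrite -msqE.
    by congr msq; apply/funext => w; rewrite /u /truncate ltn_ord.
  move=> k; rewrite add0n => Nk _; rewrite -msqE.
  rewrite (_ : u k = fun=> 0) ?msq_cst ?enorm0 ?expr0n//.
  by apply/funext => w; rewrite /u /truncate ltnNge Nk.
have ioE k : (k < N)%N -> io_operator A B C theta u k = io_operator A B C theta v k.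
  move=> kN; apply/funext => w; rewrite /io_operator.
  by rewrite forced_state_truncate// ltnW.
have u_lt : (l2_sqnorm P u < +oo)%E.
  by rewrite u_norm; apply: lte_sum_pinfty => k _; exact: v_fin.
have u0 : (0 <= l2_sqnorm P u)%E.
  by rewrite u_norm sume_ge0// => k _; exact: msq_ge0.
(* [io_gain] excludes inputs that vanish almost surely; for these the forced state, hence the
   output, vanishes almost surely as well. *)
have [u_zero|u_nz] := pselect (l2_zero P u).
  rewrite big1; first by rewrite mule_ge0// ?lee_fin ?(ltW gamma_gt0)// -u_norm.
  move=> k _; rewrite -ioE//.
  have /ae_foralln uz := u_zero.
  apply/eqP; rewrite eq_le msq_ge0 andbT.
  have mio : measurable_mx (io_operator A B C theta u k).
    apply: measurable_mxM; first exact: (measurable_mx_comp mC).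
    by apply: measurable_forced_state => j; exact: past_measurable_mx (pu j).
  suff : (msq P (io_operator A B C theta u k) <=
          0%:E * msq P (fun=> 0%R : 'cV[R]_r))%E by rewrite mul0e.
  apply: msq_ae_le => //.
  apply: filterS uz => w uw; rewrite mul0r /io_operator.
  suff -> : forced_state A B theta u k w = 0 by rewrite mulmx0 enorm0 expr0n.
  have {}uw j : u j w = 0 by exact: uw.
  elim: (nat_of_ord k) => [//|j IHj] /=.
  by rewrite IHj uw !mulmx0 addr0.
have u_l2 : l2 P theta u.
  split=> // k i Y mY; have := pu k i 0 measurableT Y mY.
  by rewrite setTI.
have := io_gain thetaP u_l2 u_nz.
have gu_fin : (gamma%:E * l2_sqnorm P u)%E \is a fin_num.
  by rewrite fin_numM// ge0_fin_numE.
rewrite sube_lt0 ?gu_fin ?orbT// -u_norm => /ltW/(le_trans _); apply.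
(* The truncated input may keep producing output after time [N]; that nonnegative tail is
   dropped. *)
rewrite /l2_sqnorm (nneseries_split 0 N); last by move=> k _; rewrite -msqE msq_ge0.
rewrite add0n big_mkord [leLHS](_ : _ = \sum_(k < N)
    'E_P[fun w => (enorm (io_operator A B C theta u k w) ^+ 2)%R])%E.
  by rewrite leeDl// nneseries_ge0// => k _ _; rewrite -msqE msq_ge0.
by apply: eq_bigr => k _; rewrite -ioE// msqE.
Qed.

Lemma superposition v x0 k w :
  free_state A theta x0 k w + forced_state A B theta v k w =
  if k is j.+1 then
    A (theta j w) *m (free_state A theta x0 j w + forced_state A B theta v j w)
      + B (theta j w) *m v j w
  else x0.
Proof. by case: k => [|k] /=; rewrite ?addr0// mulmxDr addrA. Qed.

(** * Energy estimates along a closed-loop trajectory *)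

Section closed_loop_trajectory.
Variable x0 : 'cV[R]_n.

Let x k w := free_state closed_loop theta x0 k w.
Let z k w := C (theta k w) *m x k w.
Let v k w := D (theta k w) *m z k w.

Let past_x k :
  @measurable_mx R _ (g_sigma_algebraType (past_generator theta k)) n 1 (x k).
Proof.
rewrite (_ : x k = (fun w => transition closed_loop theta k w *m x0)).
  apply: measurable_mxM; last exact: measurable_mx_cst.
  by apply: past_measurable_transition => //; exact: measurable_closed_loop.
by apply/funext => w; rewrite /x free_stateE.
Qed.

Let past_z k :
  @measurable_mx R _ (g_sigma_algebraType (past_generator theta k)) r 1 (z k).
Proof.
apply: measurable_mxM => //; apply: (measurable_mx_comp mC).
exact: past_measurable_theta.
Qed.

Let past_v k :
  @measurable_mx R _ (g_sigma_algebraType (past_generator theta k)) r 1 (v k).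
Proof.
apply: measurable_mxM => //; apply: (measurable_mx_comp mD).
exact: past_measurable_theta.
Qed.

Let past_Bv k :
  @measurable_mx R _ (g_sigma_algebraType (past_generator theta k)) n 1
    (fun w => B (theta k w) *m v k w).
Proof.
apply: measurable_mxM => //; apply: (measurable_mx_comp mB).
exact: past_measurable_theta.
Qed.

Let mx k : measurable_mx (x k) := past_measurable_mx (@past_x k).
Let mz k : measurable_mx (z k) := past_measurable_mx (@past_z k).
Let mv k : measurable_mx (v k) := past_measurable_mx (@past_v k).
Let mBv k : measurable_mx (fun w => B (theta k w) *m v k w) :=
  past_measurable_mx (@past_Bv k).

Let x_rec k w : x k.+1 w = A (theta k w) *m x k w + B (theta k w) *m v k w.
Proof. by rewrite /x/= /closed_loop mulmxDl /v /z -!mulmxA. Qed.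

Let x_decomp k w : x k w = free_state A theta x0 k w + forced_state A B theta v k w.
Proof.
elim: k => [|k IHk]; first by rewrite superposition.
by rewrite x_rec IHk [RHS]superposition.
Qed.

Let z_le k : (msq P (z k) <= (c ^+ 2)%:E * msq P (x k))%E.
Proof. exact: (msq_mulmx_le g_measurable g_ge0 G_density g_pos thetaP). Qed.

Let v_le k : (msq P (v k) <= (del ^+ 2)%:E * msq P (z k))%E.
Proof. exact: (msq_mulmx_le g_measurable g_ge0 G_density g_pos thetaP). Qed.

Let Bv_le k :
  (msq P (fun w => B (theta k w) *m v k w) <= (b ^+ 2)%:E * msq P (v k))%E.
Proof. exact: (msq_mulmx_le g_measurable g_ge0 G_density g_pos thetaP). Qed.

Let msq_scale_lty (s : R) (e f : \bar R) :
  (f <= s%:E * e -> 0 <= e -> e < +oo -> f < +oo)%E.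
Proof.
move=> fe e0 eoo; apply: le_lt_trans fe _.
by rewrite -(@fineK _ e) ?ge0_fin_numE// -EFinM ltry.
Qed.

(** Finiteness at each time, with no uniformity, allows the energies to be treated as real numbers,
    so that terms can be subtracted from both sides. *)
Let x_lty k : (msq P (x k) < +oo)%E.
Proof.
elim: k => [|k IHk]; first by rewrite -[x 0%N]/(fun=> x0) msq_cst ltry.
have z_lty := msq_scale_lty (z_le k) (msq_ge0 _ _) IHk.
have v_lty := msq_scale_lty (v_le k) (msq_ge0 _ _) z_lty.
have Bv_lty := msq_scale_lty (Bv_le k) (msq_ge0 _ _) v_lty.
have mAx : measurable_mx (fun w => A (theta k w) *m x k w).
  by apply: measurable_mxM => //; exact: (measurable_mx_comp mA).
have Ax_le : (msq P (fun w => A (theta k w) *m x k w) <= (a ^+ 2)%:E * msq P (x k))%E.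
  exact: (msq_mulmx_le g_measurable g_ge0 G_density g_pos thetaP).
have Ax_lty := msq_scale_lty Ax_le (msq_ge0 _ _) IHk.
rewrite (_ : x k.+1 = fun w => A (theta k w) *m x k w + B (theta k w) *m v k w).
  apply: le_lt_trans (msqD_young P ltr01 mAx (mBv k)) _.
  by apply: lte_add_pinfty; rewrite (msq_scale_lty (lexx _))// msq_ge0.
by apply/funext => w; rewrite x_rec.
Qed.

Let u k := fine (msq P (x k)).
Let p k := fine (msq P (z k)).
Let q k := fine (msq P (v k)).

Let uE k : (u k)%:E = msq P (x k).
Proof. by rewrite fineK// ge0_fin_numE// msq_ge0. Qed.
Let z_lty k := msq_scale_lty (z_le k) (msq_ge0 _ _) (x_lty k).
Let pE k : (p k)%:E = msq P (z k).
Proof. by rewrite fineK// ge0_fin_numE// msq_ge0. Qed.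
Let v_lty k := msq_scale_lty (v_le k) (msq_ge0 _ _) (z_lty k).
Let qE k : (q k)%:E = msq P (v k).
Proof. by rewrite fineK// ge0_fin_numE// msq_ge0. Qed.

Let q_le k : q k <= del ^+ 2 * p k.
Proof. by rewrite -lee_fin EFinM pE qE. Qed.

Let q_ge0 k : 0 <= q k. Proof. by rewrite fine_ge0// msq_ge0. Qed.

Let alpha_sum N : \sum_(k < N) alpha ^+ k <= (1 - alpha)^-1.
Proof.
have a1 : 0 < 1 - alpha by rewrite subr_gt0.
have st k : alpha ^+ k.+1 <= alpha * alpha ^+ k + 0 by rewrite addr0 exprS.
have := sum_le_of_affine_recursion (ltW alpha_gt0)
  (fun k => exprn_ge0 k (ltW alpha_gt0)) (fun=> lexx 0) st N.
by rewrite [X in _ <= _ + X]big1// addr0 expr0 -ler_pdivlMl// mulr1.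
Qed.

(** The output is the response to [v] plus the output of the free trajectory. After Young's
    inequality, the response costs at most [(1 + eta1) * (gamma * del ^+ 2)] times the left side and
    is absorbed; the free part is a geometric sum. *)
Lemma output_energy_le N :
  \sum_(k < N) p k <= output_const * enorm x0 ^+ 2.
Proof.
have gd0 : 0 <= gamma * del ^+ 2 by rewrite mulr_ge0 ?sqr_ge0// ltW.
have e0 : 0 < eta1 by rewrite divr_gt0// subr_gt0.
have rho_lt1 : 0 < 1 - (1 + eta1) * (gamma * del ^+ 2).
  exact: young_margin.
rewrite /output_const mulrAC ler_pdivlMr//.
pose Y := \sum_(k < N) p k; rewrite -/Y mulrBr mulr1 lerBlDr.
have mfree k : measurable_mx (free_state A theta x0 k).
  rewrite (_ : free_state _ _ _ _ = (fun w => transition A theta k w *m x0)).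
    apply: measurable_mxM; last exact: measurable_mx_cst.
    exact: measurable_transition.
  by apply/funext => w; rewrite free_stateE.
have mCfree k : measurable_mx (fun w => C (theta k w) *m free_state A theta x0 k w).
  by apply: measurable_mxM => //; exact: (measurable_mx_comp mC).
have mio k : measurable_mx (io_operator A B C theta v k).
  by apply: measurable_mxM; [exact: (measurable_mx_comp mC)
    |exact: measurable_forced_state].
have Cfree k : (msq P (fun w => C (theta k w) *m free_state A theta x0 k w) <=
    (c ^+ 2 * (beta * alpha ^+ k * enorm x0 ^+ 2))%:E)%E.
  apply: le_trans (msq_mulmx_le g_measurable g_ge0 G_density g_pos thetaP _ mC
    (mfree k) C_le) _.
  by rewrite [leRHS]EFinM lee_wpmul2l// ?lee_fin ?sqr_ge0// A_stable.
have zE k : z k = fun w => io_operator A B C theta v k w +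
                           C (theta k w) *m free_state A theta x0 k w.
  by apply/funext => w; rewrite /z x_decomp mulmxDr addrC.
have e1 : 0 <= 1 + eta1 by rewrite addr_ge0// ltW.
have e2 : 0 <= 1 + eta1^-1 by rewrite addr_ge0// invr_ge0 ltW.
have : ((\sum_(k < N) p k)%:E <= ((1 + eta1) * (gamma * \sum_(k < N) q k))%:E +
   ((1 + eta1^-1) * \sum_(k < N) (c ^+ 2 * (beta * alpha ^+ k * enorm x0 ^+ 2)))%:E)%E.
  rewrite -sumEFin; under eq_bigr do rewrite pE zE.
  apply: (@le_trans _ _ (\sum_(k < N) ((1 + eta1)%:E * msq P (io_operator A B C theta v k)
    + (1 + eta1^-1)%:E * msq P (fun w => C (theta k w) *m free_state A theta x0 k w)))%E).
    by apply: lee_sum => k _; exact: msqD_young.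
  rewrite big_split/= -!ge0_sume_distrr; try by move=> k _; exact: msq_ge0.
  rewrite !EFinM; apply: leeD; apply: lee_wpmul2l; rewrite ?lee_fin//.
    apply: le_trans (finite_horizon_gain N past_v v_lty) _.
    rewrite -sumEFin; under eq_bigr do rewrite -qE.
    exact: lexx.
  by rewrite -sumEFin; apply: lee_sum => k _; exact: Cfree.
rewrite -EFinD lee_fin => /le_trans; apply; rewrite addrC; apply: lerD.
  rewrite -mulr_sumr; under eq_bigr do rewrite mulrAC.
  rewrite -mulr_sumr.
  have := alpha_sum N; set s := \sum_(k < N) alpha ^+ k => s_le.
  rewrite -[leRHS]mulrA; apply: ler_wpM2l => //.
  rewrite -[leRHS]mulrA ler_wpM2l ?sqr_ge0//.
  rewrite -[leLHS]mulrA -[leRHS]mulrA ler_wpM2l ?(ltW beta_gt0)//.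
  by rewrite mulrC ler_wpM2r// sqr_ge0.
rewrite [leRHS]mulrC -[leRHS]mulrA ler_wpM2l// -[leRHS]mulrA.
apply: ler_wpM2l; first exact: ltW.
by rewrite /Y mulr_sumr; apply: ler_sum => k _; exact: q_le.
Qed.

(** A majorant for the energy of the state measured through its whole future free evolution. *)
Let Rseq := fix F k := if k is j.+1 then
  (1 + eta2) * alpha * F j + input_const * q j else beta * enorm x0 ^+ 2.

(** Induction on [k] for all [m] at once: [A x(k)] evolving for [m] steps is [x(k)] evolving for
    [m.+1] steps, which gains the factor [alpha]. Stability is invoked afresh only for the new input
    [B v(k)], so [beta] and [n] do not multiply up from step to step. *)
Lemma free_evolution_le k m :
  (msq P (fun w => transition A (shift_chain k theta) m w *m x k w) <=
   (alpha ^+ m * Rseq k)%:E)%E.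
Proof.
have e0 : 0 < eta2 by rewrite divr_gt0// subr_gt0.
have e1 : 0 <= 1 + eta2 by rewrite addr_ge0// ltW.
have e2 : 0 <= 1 + eta2^-1 by rewrite addr_ge0// invr_ge0 ltW.
have mtr i j : measurable_mx (transition A (shift_chain j theta) i).
  by apply: measurable_transition => // l; exact: mtheta.
elim: k m => [|k IHk] m.
  have := A_stable thetaP x0 m; rewrite /= mulrA [_ * beta]mulrC.
  by congr (msq _ _ <= _)%E; apply/funext => w; rewrite free_stateE.
have split w : transition A (shift_chain k.+1 theta) m w *m x k.+1 w =
    transition A (shift_chain k theta) m.+1 w *m x k w +
    transition A (shift_chain k.+1 theta) m w *m (B (theta k w) *m v k w).
  rewrite x_rec mulmxDr; congr (_ + _).
  rewrite -[m.+1]add1n transition_add/= mulmx1 -mulmxA /shift_chain addn0.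
  congr (transition _ _ _ _ *m _); apply/funext => i.
  by rewrite add1n addnS.
have Bv : (msq P (fun w => transition A (shift_chain k.+1 theta) m w *m
    (B (theta k w) *m v k w)) <= (n%:R * (beta * alpha ^+ m) * (b ^+ 2 * q k))%:E)%E.
  (* Used with a single summand: the input term is determined by the past up to [k], and the
     transition matrix by the chain from [k.+1] on. *)
  have := @msq_random_vector_le _ _ _ _ _ _ g_measurable g_ge0 G_density g_pos _ _ _ _
    thetaP n n 1 k (fun=> transition A (shift_chain k.+1 theta) m)
    (fun w => B (theta k w) *m v k w) (beta * alpha ^+ m).
  rewrite big_ord1 => h; apply: le_trans (h _ _ _ _) _ => //.
  - by rewrite mulr_ge0 ?(ltW beta_gt0)// exprn_ge0// ltW.
  - move=> Q QP y0; rewrite big_ord1; have := A_stable QP y0 m.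
    by congr (msq _ _ <= _)%E; apply/funext => w; rewrite free_stateE.
  - rewrite [leRHS]EFinM lee_wpmul2l ?lee_fin ?mulr_ge0 ?(ltW beta_gt0) ?exprn_ge0 ?(ltW alpha_gt0)//.
    by rewrite [leRHS]EFinM qE Bv_le.
rewrite (_ : msq P _ = msq P (fun w =>
    transition A (shift_chain k theta) m.+1 w *m x k w +
    transition A (shift_chain k.+1 theta) m w *m (B (theta k w) *m v k w))); last first.
  by congr msq; apply/funext.
apply: le_trans (msqD_young P e0 (measurable_mxM (mtr m.+1 k) (mx k))
  (measurable_mxM (mtr m k.+1) (mBv k))) _.
apply: (@le_trans _ _ ((1 + eta2)%:E * (alpha ^+ m.+1 * Rseq k)%:E +
  (1 + eta2^-1)%:E * (n%:R * (beta * alpha ^+ m) * (b ^+ 2 * q k))%:E)%E).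
  by apply: leeD; apply: lee_wpmul2l; rewrite ?lee_fin.
rewrite -!EFinM -EFinD lee_fin /= /input_const exprS.
by rewrite le_eqVlt; apply/orP; left; apply/eqP; ring.
Qed.

Lemma closed_loop_energy_le N :
  (\sum_(k < N) msq P (free_state closed_loop theta x0 k) <=
   (closed_loop_const * enorm x0 ^+ 2)%:E)%E.
Proof.
have e0 : 0 < eta2 by rewrite divr_gt0// subr_gt0.
have ra0 : 0 <= (1 + eta2) * alpha by rewrite mulr_ge0 ?addr_ge0// ltW.
have ra1 : 0 < 1 - (1 + eta2) * alpha by apply: young_margin => //; exact: ltW.
have ic0 : 0 <= input_const.
  by rewrite /input_const !mulr_ge0 ?addr_ge0 ?invr_ge0 ?sqr_ge0// ltW.
have R0 k : 0 <= Rseq k.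
  elim: k => [|k IHk] /=; first by rewrite mulr_ge0 ?sqr_ge0// ltW.
  by rewrite addr_ge0// mulr_ge0.
apply: (@le_trans _ _ (\sum_(k < N) Rseq k)%:E).
  rewrite -sumEFin; apply: lee_sum => k _.
  (* Zero steps of free evolution: [Rseq k] bounds the energy of the state itself. *)
  have := free_evolution_le k 0; rewrite expr0 mul1r.
  by congr (msq _ _ <= _)%E; apply/funext => w; rewrite mul1mx.
rewrite lee_fin /closed_loop_const mulrAC ler_pdivlMr// mulrC.
have := @sum_le_of_affine_recursion R Rseq (fun k => input_const * q k)
  ((1 + eta2) * alpha) ra0 R0 _ (fun=> lexx _) N.
move=> /(_ (fun k => mulr_ge0 ic0 (q_ge0 k)))/le_trans; apply.
rewrite /= mulrDl lerD2l -mulr_sumr -[leRHS]mulrA; apply: ler_wpM2l => //.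
apply: (@le_trans _ _ (\sum_(k < N) del ^+ 2 * p k)).
  by apply: ler_sum => k _; exact: q_le.
by rewrite -mulr_sumr -[leRHS]mulrA ler_wpM2l ?sqr_ge0// output_energy_le.
Qed.

End closed_loop_trajectory.
End one_chain.

Lemma closed_loop_stable : ems_stable mu G closed_loop.
Proof.
have e1 : 0 < eta1 by rewrite divr_gt0// subr_gt0.
have e2 : 0 < eta2 by rewrite divr_gt0// subr_gt0.
have gd0 : 0 <= gamma * del ^+ 2 by rewrite mulr_ge0 ?sqr_ge0// ltW.
have r1 : 0 < 1 - (1 + eta1) * (gamma * del ^+ 2).
  exact: young_margin.
have r2 : 0 < 1 - (1 + eta2) * alpha by apply: young_margin => //; exact: ltW.
apply: (ems_stable_of_summable g_measurable g_ge0 G_density g_pos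
  (M := closed_loop_const)).
- exact: measurable_closed_loop.
- have be0 := ltW beta_gt0; have a1 : 0 <= 1 - alpha by rewrite subr_ge0 ltW.
  have f1 : 0 <= 1 + eta1^-1 by rewrite addr_ge0// invr_ge0 ltW.
  have f2 : 0 <= 1 + eta2^-1 by rewrite addr_ge0// invr_ge0 ltW.
  have oc0 : 0 <= output_const.
    by rewrite divr_ge0 ?(ltW r1)// !mulr_ge0 ?sqr_ge0 ?invr_ge0.
  have ic0 : 0 <= input_const.
    by rewrite mulr_ge0// mulr_ge0 ?sqr_ge0// mulr_ge0.
  by rewrite divr_ge0 ?(ltW r2)// addr_ge0// mulr_ge0// mulr_ge0 ?sqr_ge0.
- move=> dO Omega P theta thetaP x0 N; exact: closed_loop_energy_le.
Qed.
End small_gain.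

(** * Passage from the small-gain estimate to the stability radius *)

Lemma exists_gain_margin (R : realFieldType) (x del : R) :
  0 <= del -> x * del < 1 -> exists2 s, x < s & s * del < 1.
Proof.
move=> del0 xdel; have d1 : 0 < del + 1 by rewrite ltr_wpDl.
exists (x + (1 - x * del) / (2 * (del + 1))).
  by rewrite ltrDl divr_gt0// ?subr_gt0// mulr_gt0.
rewrite mulrDl -ltrBrDl mulrAC ltr_pdivrMr ?mulr_gt0//.
by rewrite ltr_pM2l ?subr_gt0//; lra.
Qed.

Theorem theorem2 (R : realType)
  (S : metricType R) (Scomplete : complete_space S)
  (Sseparable : separable_space S)
  (Theta : set S) (Theta_borel : <<s @open S >> Theta) (theta_pt : Theta)
  (mu : {sigma_finite_measure set (borel_subset theta_pt) -> \bar R})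
  (G : R.-pker (borel_subset theta_pt) ~> (borel_subset theta_pt))
  (g : borel_subset theta_pt * borel_subset theta_pt -> R)
  (g_measurable : measurable_fun setT g)
  (g_ge0 : forall l t, 0 <= g (l, t))
  (G_density : forall l L, measurable L ->
     G l L = (\int[mu]_(t in L) (g (l, t))%:E)%E)
  (g_pos : {ae mu, forall l, (0 < \int[mu]_t (g (t, l))%:E)%E})
  (n r : nat)
  (A : borel_subset theta_pt -> 'M[R]_n)
  (B : borel_subset theta_pt -> 'M[R]_(n, r))
  (C : borel_subset theta_pt -> 'M[R]_(r, n))
  (A_Hinf : Hinf mu A) (B_Hinf : Hinf mu B) (C_Hinf : Hinf mu C)
  (A_stable : ems_stable mu G A) :
  (stability_radius mu G A B C >= (io_norm mu G A B C)^-1)%E.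
Proof.
apply: le_ereal_inf_tmp => _ [Delta [Delta_Hinf not_stable] <-].
rewrite leNgt; apply/negP => Delta_lt; apply: not_stable.
(* A zero measure would give the kernel total mass 0 instead of 1. Positivity of [mu] is what makes
   the essential supremum of a nonnegative function nonnegative. *)
have muT : (0 < mu setT)%E.
  rewrite lt0e measure_ge0 andbT; apply/eqP => muT0.
  have := prob_kernel (s := G) theta_pt.
  rewrite G_density// null_set_integral//; first by move/esym/eqP; rewrite onee_eq0.
  by apply/measurable_EFinP; exact: (measurable_fun_pair2 _ g_measurable).
have Delta_ge0 : (0 <= Hinf_norm mu Delta)%E.
  by apply: ess_sup_ger => // l; rewrite lee_fin spectral_norm_ge0.
have Delta_le := ess_sup_ge mu (fun l => (spectral_norm (Delta l))%:E).
rewrite -/(Hinf_norm mu Delta) in Delta_le.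
have [mDelta Delta_lty] := Delta_Hinf.
have [del delE] : exists del, Hinf_norm mu Delta = del%:E.
  by exists (fine (Hinf_norm mu Delta)); rewrite fineK// ge0_fin_numE.
rewrite {}delE lee_fin in Delta_lt Delta_ge0 Delta_le.
have io_ge0 : (0 <= io_norm mu G A B C)%E.
  by apply: le_ereal_inf_tmp => _ [gamma _ <-]; rewrite lee_fin sqrtr_ge0.
(* An infinite gain has inverse 0, contradicting [0 <= del]; a zero gain has inverse [+oo], and then
   [x * del = 0]. *)
have [x ioE xdel] : exists2 x, io_norm mu G A B C = x%:E & x * del < 1.
  move: io_ge0 Delta_lt; case: (io_norm mu G A B C) => [x x0|_|//].
  - exists x => //; move: Delta_lt; rewrite inver.
    have [->|xn0] := eqVneq x 0; first by rewrite mul0r.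
    rewrite lte_fin => dx; rewrite mulrC -ltr_pdivlMr ?div1r//.
    by rewrite lt_def xn0 -lee_fin.
  - by rewrite invey lte_fin ltNge Delta_ge0.
(* The infimum defining [io_norm] need not be attained, so an admissible [gamma] is sought with
   square root below a slightly larger [s]. *)
have [s xs sdel] := exists_gain_margin Delta_ge0 xdel.
have : (io_norm mu G A B C < s%:E)%E by rewrite ioE lte_fin.
move=> /ereal_inf_lt[_ [gamma [gamma_gt0 gain] <-]]; rewrite lte_fin => gs.
have gdel : gamma * del ^+ 2 < 1.
  rewrite -(sqr_sqrtr (ltW gamma_gt0)) -exprMn -(expr1n _ 2).
  rewrite ltrXn2r ?nnegrE ?mulr_ge0 ?sqrtr_ge0//=.
  by apply: le_lt_trans sdel; rewrite ler_wpM2r// ltW.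
have [a a0 A_le] := Hinf_bound A_Hinf.
have [b b0 B_le] := Hinf_bound B_Hinf.
have [c c0 C_le] := Hinf_bound C_Hinf.
have [beta [alpha [beta0 /andP[alpha0 alpha1] A_decay]]] := A_stable.
apply: (closed_loop_stable g_measurable g_ge0 G_density g_pos A_Hinf.1 B_Hinf.1
  C_Hinf.1 mDelta b0 c0 A_le B_le C_le Delta_le beta0 alpha0 alpha1 _ gamma_gt0 _ gdel).
- move=> dO Omega P theta [nu0 nu0P thetaP] x0 k; rewrite msqE.
  exact: A_decay nu0P thetaP k.
- by move=> dO Omega P theta v [nu0 nu0P thetaP]; exact: gain nu0P thetaP.
Qed.
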